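(* Let $\ell\ge2$ and let $$\dot{\mathfrak g}=\left\{\begin{pmatrix}a&b\\c&-a^T\end{pmatrix}\in M_{4\ell}(\mathbb C)\ \Big|\ b^T=b,\ c^T=c\right\}$$ ($a,b,c$ being $2\ell\times2\ell$ blocks), the simple Lie algebra of type $C_{2\ell}$. Put $$\sigma_0=\mathrm{Ad}\Big(\sum_{i=1}^{4\ell}(-1)^iE_{i,4\ell+1-i}\Big),\quad \sigma_1=\mathrm{Ad}\Big(\sum_{i=1}^{2\ell}\big((-1)^iE_{i,4\ell+1-i}-(-1)^iE_{2\ell+i,2\ell+1-i}\big)\Big).$$ Then $\dot{\mathfrak g}_{(\overline0,\overline0)}$ is the simple Lie algebra of type $C_\ell$; as modules over it, $\dot{\mathfrak g}_{(\overline0,\overline1)}$ and $\dot{\mathfrak g}_{(\overline1,\overline0)}$ are both the adjoint representation, and $\dot{\mathfrak g}_{(\overline1,\overline1)}$ is the direct sum of a $(2\ell^2-\ell-1)$-dimensional irreducible representation and a one-dimensional one; and the set $R$ of non-isotropic roots of the twisted 2-toroidal Lie algebra $\mathfrak g(\sigma_0,\sigma_1)$ is the extended affine root system $C_\ell^{(1,1)*}$: $$R=\{\alpha+m\delta_0+n\delta_1\mid\alpha\in R(C_\ell)\text{ long},\ m,n\in\mathbb Z,\ mn\in2\mathbb Z\}\cup\{\alpha+m\delta_0+n\delta_1\mid\alpha\in R(C_\ell)\text{ short},\ m,n\in\mathbb Z\},$$ where $R(C_\ell)$ is the root system of $\dot{\mathfrak g}_{(\overline0,\overline0)}$ with respect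 to its Cartan subalgebra $\dot{\mathfrak h}_{\overline0}$.
   Context: $E_{ij}$ are matrix units and $\mathrm{Ad}(A)(X)=AXA^{-1}$. Work over $\mathbb C$. Let $\dot{\mathfrak g}$ be a simple finite-dimensional Lie algebra with Killing form $(\cdot,\cdot)$, and $\sigma_0,\sigma_1$ commuting automorphisms of finite orders $n_0,n_1$ (order 1 allowed). Put $\epsilon_j=\exp(2\pi i/n_j)$ and, for $p,q\in\mathbb Z$, $\dot{\mathfrak g}_{(\overline p,\overline q)}=\{g\in\dot{\mathfrak g}\mid\sigma_0(g)=\epsilon_0^p g,\ \sigma_1(g)=\epsilon_1^q g\}$, where $\overline p=p \bmod n_0$, $\overline q=q\bmod n_1$. Let $\mathcal R=\mathbb C[t_0^{\pm1},t_1^{\pm1}]$, $\mathcal K=\Omega^1_{\mathcal R}/d\mathcal R$, $k_i=t_i^{-1}dt_i$, and let $\mathcal K(\Sigma)\subset\mathcal K$ be spanned by the elements $t_0^{n_0a}t_1^{n_1b}k_i$ ($a,b\in\mathbb Z$, $i=0,1$). The twisted 2-toroidal Lie algebra is $$\mathfrak g(\sigma_0,\sigma_1)=\bigoplus_{m,n\in\mathbb Z}\dot{\mathfrak g}_{(\overline m,\overline n)}\otimes t_0^mt_1^n\ \oplus\ \mathcal K(\Sigma)\ \oplus\ \mathbb Cd_0\oplus\mathbb Cd_1,$$ with bracket $[g_1\otimes f_1,g_2\otimes f_2]=[g_1,g_2]\otimes f_1f_2+(g_1,g_2)f_2\,df_1$; $\mathcal K(\Sigma)$ commutes with itself and with all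 $g\otimes f$; $d_j=t_j\partial/\partial t_j$ acts by $[d_j,g\otimes t_0^{r_0}t_1^{r_1}]=r_j\,g\otimes t_0^{r_0}t_1^{r_1}$, $[d_j,t_0^{r_0}t_1^{r_1}k_i]=r_j\,t_0^{r_0}t_1^{r_1}k_i$; and $[d_0,d_1]=0$. Let $\dot{\mathfrak h}_{\overline 0}$ be a Cartan subalgebra of the reductive algebra $\dot{\mathfrak g}_{(\overline 0,\overline 0)}$ and $\mathfrak h=\dot{\mathfrak h}_{\overline 0}\oplus\mathbb Cd_0\oplus\mathbb Cd_1\oplus\mathbb Ck_0\oplus\mathbb Ck_1$. Elements of $\dot{\mathfrak h}_{\overline 0}^*$ are extended to $\mathfrak h$ by $0$ on all $d_i,k_i$; $\delta_i\in\mathfrak h^*$ is defined by $\delta_i(d_j)=\delta_{ij}$ and zero on $\dot{\mathfrak h}_{\overline 0}$ and all $k_j$. Let $V=\dot{\mathfrak h}_{\overline 0}^*\oplus\mathbb C\delta_0\oplus\mathbb C\delta_1$ with the bilinear form $(\cdot,\cdot)_V$ which on $\dot{\mathfrak h}_{\overline 0}^*$ is dual to the restriction of the Killing form to $\dot{\mathfrak h}_{\overline 0}$ and has $\delta_0,\delta_1$ in its radical. Then $R$ is the set of $\beta\in V$ with $(\beta,\beta)_V\ne0$ whose weight space in $\mathfrak g(\sigma_0,\sigma_1)$ under the adjoint action of $\mathfrak h$ is nonzero. *)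

(* Defs.v *)
(* The complex numbers are R[i], for R : realType. *)
From HB Require Import structures.
From mathcomp Require Import all_boot all_order all_algebra.
From mathcomp Require Import generic_quotient ring_quotient.
From mathcomp Require Import complex.
From mathcomp Require Import all_classical all_reals all_analysis.

Set Implicit Arguments.
Unset Strict Implicit.
Unset Printing Implicit Defensive.

Import Order.TTheory GRing.Theory Num.Theory.
Local Open Scope classical_set_scope.
Local Open Scope ring_scope.

(* Finite-dimensional Lie algebras are subspaces of a matrix algebra, with the
   commutator as bracket. *)
Section LinearLie.
Variables (K : fieldType) (N : nat).
Local Notation M := 'M[K]_N.
Implicit Types (L H U : {vspace M}).

Definition comm (x y : M) : M := x *m y - y *m x.

Definition lie_subalg L : Prop :=
  forall x y, x \in L -> y \in L -> comm x y \in L.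

Definition stable L U : Prop :=
  forall x y, x \in L -> y \in U -> comm x y \in U.

Definition simple_lie L : Prop :=
  [/\ lie_subalg L,
      exists x y, [/\ x \in L, y \in L & comm x y != 0]
    & forall I, (I <= L)%VS -> stable L I -> I = 0%VS \/ I = L].

Definition lie_prod L U : {vspace M} :=
  <<[seq comm x y | x <- vbasis L, y <- vbasis U]>>%VS.

Definition nilpotent_lie H : Prop := exists k, iter k (lie_prod H) H = 0%VS.

Definition cartan_subalg L H : Prop :=
  [/\ (H <= L)%VS, lie_subalg H, nilpotent_lie H
    & forall x, x \in L -> (forall y, y \in H -> comm x y \in H) -> x \in H].

(* The trace of ad x o ad y on L, for x, y in L. *)
Definition killing L (x y : M) : K :=
  \sum_(i < \dim L) coord (vbasis L) i (comm x (comm y (vbasis L)`_i)).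

(* L acts on U and on W by the bracket. *)
Definition mod_iso L U W : Prop :=
  exists f : 'End(M),
    [/\ (f @: U)%VS = W, (lker f :&: U)%VS = 0%VS
      & forall x y, x \in L -> y \in U -> f (comm x y) = comm x (f y)].

Definition mod_irr L U : Prop :=
  [/\ U <> 0%VS, stable L U
    & forall W, (W <= U)%VS -> stable L W -> W = 0%VS \/ W = U].

(* Automorphisms of L are given by endomorphisms of the whole matrix space;
   the next predicates concern their restrictions to L. *)

Definition lie_aut L (s : 'End(M)) : Prop :=
  (s @: L)%VS = L /\
  forall x y, x \in L -> y \in L -> s (comm x y) = comm (s x) (s y).

Definition has_order L (s : 'End(M)) (n : nat) : Prop :=
  (0 < n)%N /\
  forall k, (forall x, x \in L -> iter k s x = x) <-> (n %| k)%N.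

Definition commuting_on L (s s' : 'End(M)) : Prop :=
  forall x, x \in L -> s (s' x) = s' (s x).

Definition dual H := 'Hom(subvs_of H, K^o).

Definition roots L H : set (dual H) :=
  [set a | a <> 0 /\ exists x, [/\ x \in L, x != 0
      & forall h : subvs_of H, comm (vsval h) x = a h *: x]].

(* h |-> killing L h, from H to its dual; an isomorphism when the Killing form
   of L is nondegenerate on H. *)
Definition killing_flat L H : 'Hom(subvs_of H, dual H) :=
  linfun (fun h : subvs_of H =>
    linfun (fun h' : subvs_of H => killing L (vsval h) (vsval h') : K^o)).

(* The form on H^* dual to the restriction to H of the Killing form of L. *)
Definition dual_form L H (a b : dual H) : K :=
  killing L (vsval ((killing_flat L H)^-1%VF a))
            (vsval ((killing_flat L H)^-1%VF b)).

End LinearLie.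

Definition lie_iso (K : fieldType) (N N' : nat)
    (L : {vspace 'M[K]_N}) (L' : {vspace 'M[K]_N'}) : Prop :=
  exists f : 'Hom('M[K]_N, 'M[K]_N'),
    [/\ (f @: L)%VS = L', (lker f :&: L)%VS = 0%VS
      & forall x y, x \in L -> y \in L -> f (comm x y) = comm (f x) (f y)].

Section Symplectic.
Variables (K : fieldType) (m : nat).

Definition sp_defect (X : 'M[K]_(m + m)) : 'M[K]_m * 'M[K]_m * 'M[K]_m :=
  (drsubmx X + (ulsubmx X)^T,
   (ursubmx X)^T - ursubmx X, (dlsubmx X)^T - dlsubmx X).

Fact sp_defect_linear : linear sp_defect.
Proof.
move=> a x y; congr (_, _, _); apply/matrixP=> i j; rewrite !mxE.
- by rewrite mulrDr addrACA.
- by rewrite mulrBr opprD addrACA.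
- by rewrite mulrBr opprD addrACA.
Qed.

HB.instance Definition _ :=
  GRing.isLinear.Build K _ _ _ sp_defect sp_defect_linear.

Definition sp : {vspace 'M[K]_(m + m)} := lker (linfun sp_defect).

Lemma mem_sp X : X \in sp <-> exists a b c : 'M[K]_m,
  [/\ b^T = b, c^T = c & X = block_mx a b c (- a^T)].
Proof.
rewrite memv_ker lfunE /=; split=> [/eqP[E1 /eqP E2 /eqP E3] | ].
  exists (ulsubmx X), (ursubmx X), (dlsubmx X); split.
  - by apply/eqP; rewrite -subr_eq0.
  - by apply/eqP; rewrite -subr_eq0.
  - by rewrite -[LHS]submxK; congr block_mx; apply/eqP; rewrite -addr_eq0 E1.
case=> a [b [c [Eb Ec ->]]]; rewrite /sp_defect.
by rewrite block_mxKul block_mxKur block_mxKdl block_mxKdr Eb Ec addNr !subrr.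
Qed.

End Symplectic.

(* The simple Lie algebra of type C_m is the one given by the matrices [sp m]. *)
Definition simple_of_type_C (K : fieldType) (m N : nat)
    (L : {vspace 'M[K]_N}) : Prop :=
  simple_lie L /\ lie_iso L (sp K m).

Definition Ad (K : fieldType) (N : nat) (A : 'M[K]_N) : 'End('M[K]_N) :=
  linfun (fun X => A *m X *m invmx A).

(* [laurent V] is V (x) K[t0^+-1, t1^+-1], with [f r] the coefficient of
   t0^(r.1) t1^(r.2) in f. *)

Section Laurent.
Variables (K : fieldType) (V : lmodType K).

Definition fin_supp : {pred (int * int) -> V} :=
  fun f => `[< finite_set [set r | f r != 0] >].

Fact fin_supp_submod : submod_closed fin_supp.
Proof.
split=> [|a f g /asboolP fP /asboolP gP]; apply/asboolP.
  by apply: (@sub_finite_set _ _ set0) => // r /=; rewrite eqxx.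
apply: (@sub_finite_set _ _ ([set r | f r != 0] `|` [set r | g r != 0])).
  move=> r; rewrite /= -[(a *: f + g) r]/(a *: f r + g r).
  have [->|] := eqVneq (f r) 0; last by left.
  by rewrite scaler0 add0r; right.
by rewrite finite_setU.
Qed.

HB.instance Definition _ :=
  GRing.isSubmodClosed.Build K ((int * int) -> V) fin_supp fin_supp_submod.

Record laurent := Laurent {
  coefl :> (int * int) -> V;
  coeflP : coefl \in fin_supp }.

HB.instance Definition _ := [isSub for coefl].
HB.instance Definition _ := [Choice of laurent by <:].
HB.instance Definition _ := [SubChoice_isSubLmodule of laurent by <:].

Lemma fin_suppP (f : (int * int) -> V) (A : set (int * int)) :
  finite_set A -> (forall r, f r != 0 -> A r) -> f \in fin_supp.
Proof. by move=> fA sA; apply/asboolP; apply: sub_finite_set fA. Qed.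

Lemma laurent_fin (f : laurent) : finite_set [set r | f r != 0].
Proof. exact/asboolP/(valP f). Qed.

Fact monol_subproof (v : V) (s : int * int) :
  (fun r => if r == s then v else 0) \in fin_supp.
Proof.
apply: (@fin_suppP _ [set s]) => // r /=.
by case: (r =P s) => // _; rewrite eqxx.
Qed.

(* v (x) t^s *)
Definition monol v s := Laurent (monol_subproof v s).

Fact der_subproof (p : int * int -> int) (f : laurent) :
  (fun r => (p r)%:~R *: f r) \in fin_supp.
Proof.
apply: fin_suppP (laurent_fin f) _ => r /=.
by apply: contraNneq => ->; rewrite scaler0.
Qed.

(* [der fst] is t0 d/dt0 and [der snd] is t1 d/dt1. *)
Definition der p f := Laurent (der_subproof p f).

Lemma laurentP (f g : laurent) : (forall r, f r = g r) -> f = g.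
Proof. by move=> fg; apply: val_inj; apply: funext. Qed.

Lemma laurentDE (f g : laurent) r : (f + g) r = f r + g r. Proof. by []. Qed.
Lemma laurentNE (f : laurent) r : (- f) r = - f r. Proof. by []. Qed.
Lemma laurentZE a (f : laurent) r : (a *: f) r = a *: f r. Proof. by []. Qed.

Fact der_linear p : linear (der p).
Proof.
move=> a f g; apply: laurentP => r.
rewrite laurentDE laurentZE /= -[(_ + _ : _ -> _) r]/(a *: f r + g r).
by rewrite scalerDr !scalerA mulrC.
Qed.

HB.instance Definition _ p :=
  GRing.isLinear.Build K laurent laurent _ (der p) (der_linear p).

Lemma der_comm p q f : der p (der q f) = der q (der p f).
Proof. by apply: laurentP => r /=; rewrite !scalerA mulrC. Qed.

End Laurent.

Arguments der {K V} p f.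

Section Convolution.
Variables (K : fieldType) (U V W : lmodType K) (op : U -> V -> W).
Hypotheses (op0l : forall y, op 0 y = 0) (op0r : forall x, op x 0 = 0).

Fact conv_subproof (f : laurent U) (g : laurent V) :
  (fun r => \sum_(s \in [set: int * int]) op (f s) (g (r - s)))
    \in @fin_supp _ W.
Proof.
apply: (@fin_suppP _ _ _ [set s.1 + s.2 | s in
    [set s | f s != 0] `*` [set s | g s != 0]]).
  by apply: finite_image; apply: finite_setX; apply: laurent_fin.
move=> r; apply: contraNP => nr; apply/eqP; apply: fsbig1 => s _.
have [->|fs] := eqVneq (f s) 0; first exact: op0l.
have [->|gs] := eqVneq (g (r - s)) 0; first exact: op0r.
by case: nr; exists (s, r - s) => //=; rewrite addrC subrK.
Qed.

(* The extension of op with op (u (x) t^s) (v (x) t^r) = op u v (x) t^(s + r). *)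
Definition conv f g := Laurent (conv_subproof f g).

End Convolution.

Section Differentials.
Variable K : fieldType.

(* (f0, f1) stands for f0 k0 + f1 k1 with ki = ti^-1 dti. *)
Definition Omega : Type := laurent K^o * laurent K^o.
HB.instance Definition _ := GRing.Lmodule.on Omega.

Definition dR (f : laurent K^o) : Omega := (der fst f, der snd f).

Definition exact_form : {pred Omega} := fun w => `[< exists f, w = dR f >].

Fact exact_submod : submod_closed exact_form.
Proof.
split=> [|a w w' /asboolP[f ->] /asboolP[g ->]]; apply/asboolP.
  by exists 0; rewrite /dR !linear0.
by exists (a *: f + g); rewrite /dR !linearP.
Qed.

HB.instance Definition _ :=
  GRing.isSubmodClosed.Build K Omega exact_form exact_submod.

(* Omega^1 / dR for the Laurent polynomial ring R *)
Definition KR : Type := Quotient.quot (exact_form : zmodClosed Omega).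
HB.instance Definition _ := GRing.Zmodule.on KR.

Definition class (w : Omega) : KR :=
  (\pi_(Quotient.quot (exact_form : zmodClosed Omega)) w)%qT.
Definition form (k : KR) : Omega :=
  (repr (k : Quotient.quot (exact_form : zmodClosed Omega)))%qT.

Lemma formK k : class (form k) = k. Proof. exact: reprK. Qed.

Lemma class_eq w w' : (class w == class w') = (w - w' \in exact_form).
Proof. by rewrite Quotient.idealrBE. Qed.

Fact class_zmod : zmod_morphism class.
Proof. exact: raddfB. Qed.
HB.instance Definition _ := GRing.isZmodMorphism.Build Omega KR class class_zmod.

Definition scaleK (a : K) (k : KR) : KR := class (a *: form k).

Lemma scale_class a w : scaleK a (class w) = class (a *: w).
Proof.
apply/eqP; rewrite class_eq -scalerBr rpredZ // -class_eq.
by rewrite formK.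
Qed.

Fact scaleK_A a b v : scaleK a (scaleK b v) = scaleK (a * b) v.
Proof. by rewrite -[v]formK !scale_class scalerA. Qed.
Fact scaleK_1 : left_id 1 scaleK.
Proof. by move=> v; rewrite -[v]formK scale_class scale1r. Qed.
Fact scaleK_Dr : right_distributive scaleK +%R.
Proof.
move=> a v w; rewrite -[v]formK -[w]formK -raddfD !scale_class.
by rewrite scalerDr raddfD.
Qed.
Fact scaleK_Dl v : {morph scaleK^~ v : a b / a + b}.
Proof. by move=> a b /=; rewrite -[v]formK !scale_class scalerDl raddfD. Qed.
HB.instance Definition _ :=
  GRing.Zmodule_isLmodule.Build K KR scaleK_A scaleK_1 scaleK_Dr scaleK_Dl.

(* The action of t_j d/dt_j on coefficients with respect to k0, k1. *)
Definition derO p (w : Omega) : Omega := (der p w.1, der p w.2).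
Definition derK p (k : KR) : KR := class (derO p (form k)).

Lemma derK_class p w : derK p (class w) = class (derO p w).
Proof.
apply/eqP; rewrite class_eq; apply/asboolP.
have /asboolP[f fE] : form (class w) - w \in exact_form.
  by rewrite -class_eq formK.
exists (der p f).
have -> : derO p (form (class w)) - derO p w = derO p (form (class w) - w).
  by rewrite /derO /= !linearB.
by rewrite fE /derO /dR /= ![der p (der _ f)]der_comm.
Qed.

End Differentials.

Section Toroidal.
Variables (R : realType) (N : nat).
Local Notation C := R[i].
Local Notation M := 'M[C]_N.
Variable g : {vspace M}.

(* exp(2 pi i / n) *)
Definition zeta (n : nat) : C :=
  (cos (2 * pi / n%:R) +i* sin (2 * pi / n%:R))%C.

Variables (s0 s1 : 'End(M)) (n0 n1 : nat).

Definition gcomp (p q : int) : {vspace M} :=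
  (g :&: passmx.leigenspace s0 (zeta n0 ^ p) :&: passmx.leigenspace s1 (zeta n1 ^ q))%VS.

(* (M (x) C[t0^+-1, t1^+-1]) + K + C d0 + C d1; the twisted toroidal algebra
   of g is the subspace [twisted] below. *)
Definition toroidal : Type := laurent M * KR C * C^o * C^o.
HB.instance Definition _ := GRing.Lmodule.on toroidal.

Fact comm0l (y : M) : comm 0 y = 0.
Proof. by rewrite /comm mul0mx mulmx0 subrr. Qed.
Fact comm0r (x : M) : comm x 0 = 0.
Proof. by rewrite /comm mul0mx mulmx0 subrr. Qed.
Fact killing0l (y : M) : (killing g 0 y : C^o) = 0.
Proof. by rewrite /killing big1 // => i _; rewrite comm0l linear0. Qed.
Fact killing0r (x : M) : (killing g x 0 : C^o) = 0.
Proof. by rewrite /killing big1 // => i _; rewrite comm0l comm0r linear0. Qed.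

Definition commL : laurent M -> laurent M -> laurent M := conv comm0l comm0r.
Definition killingL : laurent M -> laurent M -> laurent C^o :=
  conv killing0l killing0r.

(* The class of the extension of (g1 (x) f1, g2 (x) f2) |-> (g1, g2) f2 df1,
   where df1 = (t0 df1/dt0) k0 + (t1 df1/dt1) k1. *)
Definition cocycle (u v : laurent M) : KR C :=
  class (killingL (der fst u) v, killingL (der snd u) v).

Definition tor_bracket (x y : toroidal) : toroidal :=
  let: (u, k, a0, a1) := x in
  let: (v, k', b0, b1) := y in
  (commL u v + (a0 *: der fst v + a1 *: der snd v)
             - (b0 *: der fst u + b1 *: der snd u),
   cocycle u v + (a0 *: derK fst k' + a1 *: derK snd k')
               - (b0 *: derK fst k + b1 *: derK snd k),
   0, 0).

(* The span of the classes of t0^(n0 a) t1^(n1 b) ki: the classes of forms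
   whose coefficients are supported on n0 Z x n1 Z. *)
Definition KSigma : set (KR C) :=
  [set k | exists w : Omega C, k = class w /\
     forall r, ~~ ((n0%:Z %| r.1)%Z && (n1%:Z %| r.2)%Z) ->
       w.1 r = 0 /\ w.2 r = 0].

Definition twisted : set toroidal :=
  [set x : toroidal | let: (u, k, _, _) := x in
     (forall r, u r \in gcomp r.1 r.2) /\ KSigma k].

Variable H : {vspace M}.

(* (a, b0, b1) stands for a + b0 delta0 + b1 delta1. *)
Definition weightV : Type := dual H * C^o * C^o.
HB.instance Definition _ := GRing.Lmodule.on weightV.

Definition formV (b b' : weightV) : C := dual_form g b.1.1 b'.1.1.

(* h (x) 1 + c0 k0 + c1 k1 + a0 d0 + a1 d1 *)
Definition cartan_elt (h : subvs_of H) (a0 a1 c0 c1 : C) : toroidal :=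
  (monol (vsval h) 0,
   class (monol (c0 : C^o) 0, monol (c1 : C^o) 0), a0, a1).

Definition weight_eval (b : weightV) (h : subvs_of H) (a0 a1 c0 c1 : C) : C :=
  b.1.1 h + b.1.2 * a0 + b.2 * a1.

Definition weight_space (b : weightV) : set toroidal :=
  [set x | twisted x /\ forall h a0 a1 c0 c1,
     tor_bracket (cartan_elt h a0 a1 c0 c1) x =
     weight_eval b h a0 a1 c0 c1 *: x].

Definition nonisotropic_roots : set weightV :=
  [set b | formV b b <> 0 /\ exists2 x, weight_space b x & x <> 0].

(* Lengths are taken for the form on V; the order on C relates only numbers
   with the same imaginary part. *)

Definition long_roots : set (dual H) :=
  [set a | roots (gcomp 0 0) a /\
     forall b : dual H, roots (gcomp 0 0) b ->
       dual_form g b b <= dual_form g a a].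

Definition short_roots : set (dual H) :=
  [set a | roots (gcomp 0 0) a /\
     forall b : dual H, roots (gcomp 0 0) b ->
       dual_form g a a <= dual_form g b b].

(* The extended affine root system C_l^(1,1)*, for g_(0,0) of type C_l *)
Definition ears_C11star : set weightV :=
  [set b | exists a (m n : int),
     [/\ long_roots a, (2 %| m * n)%Z & b = (a, m%:~R, n%:~R)]] `|`
  [set b | exists a (m n : int), short_roots a /\ b = (a, m%:~R, n%:~R)].

End Toroidal.

(* Indices start at 0, so (-1)^i becomes (-1)^(i + 1), and i |-> 4l + 1 - i,
   i |-> 2l + 1 - i become [rev_ord]. *)

Definition A0 (K : fieldType) (l : nat) : 'M[K]_(2 * l + 2 * l) :=
  \sum_(i < 2 * l + 2 * l) (-1) ^+ i.+1 *: delta_mx i (rev_ord i).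

Definition A1 (K : fieldType) (l : nat) : 'M[K]_(2 * l + 2 * l) :=
  \sum_(i < 2 * l)
    ((-1) ^+ i.+1 *: delta_mx (lshift (2 * l) i) (rev_ord (lshift (2 * l) i))
     - (-1) ^+ i.+1 *:
       delta_mx (rshift (2 * l) i) (lshift (2 * l) (rev_ord i))).

(* Main.v *)
(* In 2l x 2l blocks, A0 = [[0, K], [K, 0]] and A1 = [[0, K], [-K, 0]], where K is
   the antidiagonal matrix of alternating signs: K is skew and K^2 = -1. With
   a* = K a^T K and S+, S- the spaces of a such that a* = a, a* = -a, the graded
   pieces of g become
     g_00 = {diag(a, -a^T) : a in S+},      g_11 = {diag(a, -a^T) : a in S-},
     g_01, g_10 = {[[0, aK], [+-Ka, 0]] : a in S+},
   and S+ is the symplectic Lie algebra of the form K, acting on S- by bracket.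
   Rank one elements x_v = v v^T K of S+ satisfy
     [x_v, [x_v, X]] = -2 K(v, X v) x_v   and, when K(u, v) = 0,
     [x_u, [x_v, X]] = - K(u, X v) (u v^T - v u^T) K   for X in S-,
   which gives the simplicity of S+ and the irreducibility of the traceless part
   of S-; dimensions and Killing forms are traces of projectors.
   A Cartan subalgebra H of S+ contains the semisimple parts of its elements
   (Jordan-Chevalley), and by Engel's theorem on (S+ n C(T)) / H it is the
   centralizer of the torus T that they span; nilpotency then makes the weights
   eps_i of C^2l nonzero and distinct, so that H = {P diag(d) P^-1 : d_(t i) = - d_i}
   for an involution t without fixed points. The roots of S+ are the eps_i + eps_j
   with j != t i, long if and only if i = j, and the nonzero weights of S- are the
   short ones. *)
From HB Require Import structures.
Require Import Defs.
From mathcomp Require Import all_boot all_order all_algebra.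
From mathcomp Require Import complex.
From mathcomp Require Import all_classical all_reals all_analysis.
From mathcomp Require Import ring zify.

Set Implicit Arguments.
Unset Strict Implicit.
Unset Printing Implicit Defensive.

Import Order.TTheory GRing.Theory Num.Theory.
Local Open Scope classical_set_scope.
Local Open Scope ring_scope.

(** * Matrices with a skew form *)

(** The four graded pieces are copies of [S+] or [S-]: [phi] embeds both on the diagonal, [psi e]
    embeds [S+] off it, and both maps intertwine the action of [S+]. Irreducibility and weights are
    thus settled once, in 2l x 2l matrices. The results on [S+] are proved for any [J] with
    [J^T = -J] and [J^2 = -1], so that they serve twice: for the antidiagonal form, and for [Jstd],
    which describes g itself and the standard model of type [C_l].

    The Cartan subalgebra is arbitrary, known only to be nilpotent and self-normalizing, and no
    conjugacy theorem is invoked; what is extracted is an eigenbasis whose Gram matrix is supported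
    on the graph of [t].

    On H the Killing form of g is [c * sum_k eps_k^2] with [c = 2(4l + 2)]. So [eps_i + eps_j], for
    j != t i, has square length [2/c] or [1/c], a positive real: lengths are comparable in the order
    of the complex numbers, and no nonzero weight is isotropic. The condition on [m n] comes from
    [S-]: the vector of weight [eps_i + eps_j] there is a difference of two dyads that cancel when i
    = j, so long roots are missing exactly when m and n are both odd. *)

Lemma comm_is_linear (K : fieldType) N (x : 'M[K]_N) : linear (comm x).
Proof. by move=> a u v; rewrite /comm linearP /= mulmxDl -scalemxAl scalerBr opprD addrACA. Qed.
HB.instance Definition _ (K : fieldType) N (x : 'M[K]_N) :=
  GRing.isLinear.Build K _ _ _ (comm x) (comm_is_linear x).

Lemma commC (K : fieldType) N (x y : 'M[K]_N) : comm y x = - comm x y.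
Proof. by rewrite /comm opprB. Qed.

Lemma comm_jacobi (K : fieldType) N (x y z : 'M[K]_N) :
  comm x (comm y z) = comm (comm x y) z + comm y (comm x z).
Proof.
rewrite /comm !mulmxBl !mulmxBr !mulmxA.
set a := x *m y *m z; set b := x *m z *m y; set c := y *m z *m x.
set d := z *m y *m x; set e := y *m x *m z; set f := z *m x *m y.
by move: a b c d e f => a b c d e f; apply/matrixP=> i j; rewrite !mxE; ring.
Qed.

Local Notation mxN := (mulmxN, mulNmx, opprK).

Lemma oppmxE (K : fieldType) m n (A : 'M[K]_(m, n)) i j : (- A) i j = - A i j.
Proof. by rewrite mxE. Qed.

Lemma tr11 (K : fieldType) (A : 'M[K]_1) : A^T = A.
Proof. by apply/matrixP=> i j; rewrite mxE !ord1. Qed.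

Section Involution.
Variables (K : numFieldType) (n : nat) (J : 'M[K]_n).
Hypotheses (JT : J^T = - J) (JJ : J *m J = - 1%:M).
Local Notation M := 'M[K]_n.
Local Notation V := 'cV[K]_n.
Implicit Types (X Y : M) (u v w : V).

(** As [J^-1 = -J], this is minus the adjoint of X for the form [u^T J v]. So [jsym 1] is the
    symplectic Lie algebra of that form and [jsym (-1)] the space of self-adjoint matrices. *)
Definition jadj (X : M) : M := J *m X^T *m J.

Lemma jadj_is_linear : linear jadj.
Proof. by move=> a u v; rewrite /jadj linearP /= mulmxDr mulmxDl -scalemxAr -scalemxAl. Qed.
HB.instance Definition _ := GRing.isLinear.Build K M M _ jadj jadj_is_linear.

Definition jsym (e : K) : {vspace M} := lker (linfun jadj - e *: \1)%VF.

Lemma jsymP e X : reflect (jadj X = e *: X) (X \in jsym e).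
Proof.
rewrite memv_ker add_lfunE opp_lfunE scale_lfunE id_lfunE lfunE /= subr_eq0.
exact: eqP.
Qed.

Lemma jadjK : involutive jadj.
Proof.
move=> X; rewrite /jadj !trmx_mul trmxK JT !mulmxA.
by rewrite !mxN -!mulmxA JJ !mulmxA JJ !mxN mulmx1 mul1mx.
Qed.

Lemma jadjM X Y : jadj (X *m Y) = - (jadj Y *m jadj X).
Proof.
rewrite /jadj trmx_mul !mulmxA -[in RHS](mulmxA _ J J) JJ.
by rewrite mulmxN mulmx1 !mulNmx opprK.
Qed.

Definition jform (u v : V) : K := (u^T *m J *m v) 0 0.

Lemma jformE u v : u^T *m J *m v = (jform u v)%:M.
Proof. exact: mx11_scalar. Qed.

Lemma jform_is_linear u : linear (jform u : V -> K^o).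
Proof. by move=> a v w; rewrite /jform linearP !mxE. Qed.
HB.instance Definition _ u :=
  GRing.isLinear.Build K V K^o _ (jform u) (jform_is_linear u).

Lemma jformC u v : jform v u = - jform u v.
Proof.
by rewrite /jform -[v^T *m J *m u]tr11 !trmx_mul trmxK JT !mxN mulmxA oppmxE.
Qed.

Lemma jform_self u : jform u u = 0.
Proof.
apply/eqP; rewrite -[_ == 0](mulrn_eq0 _ 2) /= mulr2n.
by rewrite [X in X + _]jformC addNr.
Qed.

Lemma jformDl u v w : jform (u + v) w = jform u w + jform v w.
Proof. by rewrite ![jform _ w]jformC linearD opprD. Qed.
Lemma jformZl a u w : jform (a *: u) w = a * jform u w.
Proof. by rewrite ![jform _ w]jformC linearZ mulrN. Qed.
Lemma jformDr u v w : jform w (u + v) = jform w u + jform w v.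
Proof. exact: linearD. Qed.
Lemma jformZr a u w : jform w (a *: u) = a * jform w u.
Proof. exact: linearZ. Qed.
Lemma jformNr u w : jform w (- u) = - jform w u.
Proof. exact: linearN. Qed.
Lemma jform0r w : jform w 0 = 0.
Proof. exact: linear0. Qed.

Lemma jform_delta i (u : V) : jform (J *m delta_mx i 0) u = u i 0.
Proof.
by rewrite /jform trmx_mul JT !mxN -[_ *m J *m J]mulmxA JJ !mxN mulmx1 trmx_delta -rowE mxE.
Qed.

Lemma jform_nondeg (u : V) : u != 0 -> exists v, jform v u != 0.
Proof.
move=> u0; have [i ui] : exists i, u i 0 != 0.
  apply/existsP; apply: contraNT u0; rewrite negb_exists => /forallP u0.
  by apply/eqP/matrixP=> i j; rewrite !mxE ord1; apply/eqP; rewrite -[_ == _]negbK u0.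
by exists (J *m delta_mx i 0); rewrite jform_delta.
Qed.

(** The operator [w |-> J(v, w) u]. Every matrix of rank one has this form, J being invertible. *)
Definition dyad (u v : V) : M := u *m v^T *m J.

Lemma dyadDl u v w : dyad (u + v) w = dyad u w + dyad v w.
Proof. by rewrite /dyad !mulmxDl. Qed.
Lemma dyadDr u v w : dyad w (u + v) = dyad w u + dyad w v.
Proof. by rewrite /dyad linearD mulmxDr mulmxDl. Qed.
Lemma dyadZl a u w : dyad (a *: u) w = a *: dyad u w.
Proof. by rewrite /dyad -!scalemxAl. Qed.
Lemma dyadZr a u w : dyad w (a *: u) = a *: dyad w u.
Proof. by rewrite /dyad linearZ /= -scalemxAr -scalemxAl. Qed.

Lemma dyad_app u v w : dyad u v *m w = jform v w *: u.
Proof. by rewrite /dyad -!mulmxA (mulmxA _ J) jformE mul_mx_scalar. Qed.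

Lemma dyadM u v w z : dyad u v *m dyad w z = jform v w *: dyad u z.
Proof. by rewrite {2}/dyad !mulmxA dyad_app -!scalemxAl. Qed.

Lemma mul_dyad X u v : X *m dyad u v = dyad (X *m u) v.
Proof. by rewrite /dyad !mulmxA. Qed.

Lemma jadj_dyad u v : jadj (dyad u v) = dyad v u.
Proof.
rewrite /jadj /dyad !trmx_mul trmxK JT !mulmxA mulmxN JJ opprK mul1mx.
by [].
Qed.

Lemma dyad_mul X u v : dyad u v *m X = - dyad u (jadj X *m v).
Proof.
rewrite /dyad /jadj !trmx_mul trmxK JT !mxN.
by rewrite -!mulmxA JJ !mxN mulmx1.
Qed.

Lemma jform_mul X u v : jform u (X *m v) = - jform (jadj X *m u) v.
Proof.
rewrite /jadj /jform !trmx_mul trmxK JT !mxN -oppmxE.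
by rewrite !mulmxA -(mulmxA _ J J) JJ !mxN mulmx1.
Qed.

Lemma dyad_eq0 u v : dyad u v = 0 -> u = 0 \/ v = 0.
Proof.
move=> d0; have [->|v0] := eqVneq v 0; [by right | left].
have [w] := jform_nondeg v0; rewrite jformC oppr_eq0 => vw.
have := dyad_app u v w; rewrite d0 mul0mx => /esym/eqP.
by rewrite scaler_eq0 (negPf vw) => /eqP.
Qed.

Definition sdyad u v := dyad u v + dyad v u.
Definition adyad u v := dyad u v - dyad v u.

Lemma sdyad_jsym u v : sdyad u v \in jsym 1.
Proof. by apply/jsymP; rewrite linearD /= !jadj_dyad scale1r addrC. Qed.
Lemma dyad_jsym u : dyad u u \in jsym 1.
Proof. by apply/jsymP; rewrite !jadj_dyad scale1r. Qed.
Lemma adyad_jsym u v : adyad u v \in jsym (-1).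
Proof. by apply/jsymP; rewrite linearB /= !jadj_dyad scaleN1r opprB. Qed.

Lemma comm_jsym e f X Y : X \in jsym e -> Y \in jsym f -> comm X Y \in jsym (e * f).
Proof.
move=> /jsymP EX /jsymP EY; apply/jsymP; rewrite /comm linearB /= !jadjM EX EY.
rewrite -!scalemxAl -!scalemxAr !scalerA [f * e]mulrC opprK addrC.
by rewrite scalerBr.
Qed.

Lemma jsym_subalg : lie_subalg (jsym 1).
Proof. by move=> X Y hX hY; have := comm_jsym hX hY; rewrite mul1r. Qed.

Lemma jsym_stable e : stable (jsym 1) (jsym e).
Proof. by move=> X Y hX hY; have := comm_jsym hX hY; rewrite mul1r. Qed.

Lemma comm_sdyad X u v : X \in jsym 1 ->
  comm X (sdyad u v) = sdyad (X *m u) v + sdyad u (X *m v).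
Proof.
move=> /jsymP EX; rewrite /comm /sdyad mulmxDr mulmxDl !mul_dyad !dyad_mul EX scale1r.
by rewrite opprD !opprK addrACA [dyad (X *m v) u + _]addrC addrACA.
Qed.

(** As [J(u, v) = 0], both products of the two dyads vanish, and only the cross terms [x_u X x_v]
    and [x_v X x_u] of the double bracket survive. Each is a multiple of a dyad, and e relates the
    two coefficients. *)
Lemma comm_dyad2 u v X e : X \in jsym e -> e * e = 1 -> jform u v = 0 ->
  comm (dyad u u) (comm (dyad v v) X)
  = - jform u (X *m v) *: (dyad u v + e *: dyad v u).
Proof.
move=> /jsymP EX ee uv.
have uvu : dyad u u *m dyad v v = 0 by rewrite dyadM uv scale0r.
have vuv : dyad v v *m dyad u u = 0 by rewrite dyadM jformC uv oppr0 scale0r.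
rewrite /comm mulmxBr mulmxBl mulmxA uvu mul0mx sub0r.
rewrite -[X *m dyad v v *m _]mulmxA vuv mulmx0 subr0.
rewrite mul_dyad dyadM -mulmxA mul_dyad dyadM jform_mul EX -scalemxAl jformZl.
by rewrite [jform v _]jformC !scaleNr !opprK scalerDr scalerA mulrAC ee mul1r.
Qed.

Lemma comm_dyad_sq u X : X \in jsym 1 ->
  comm (dyad u u) (comm (dyad u u) X) = (- jform u (X *m u) *+ 2) *: dyad u u.
Proof.
move=> XS; rewrite (comm_dyad2 XS) ?mulr1 ?jform_self //.
by rewrite scale1r scalerDr -scalerDl -mulr2n.
Qed.

Lemma dyad_sum X :
  X = \sum_i \sum_j X i j *: dyad (delta_mx i 0) (J *m delta_mx j 0).
Proof.
rewrite {1}[X]matrix_sum_delta; apply: eq_bigr => i _; apply: eq_bigr => j _.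
rewrite /dyad trmx_mul trmx_delta JT !mxN -!mulmxA JJ !mxN mulmx1.
by rewrite mul_delta_mx.
Qed.

Lemma jadj_sum X :
  jadj X = \sum_i \sum_j X i j *: dyad (J *m delta_mx j 0) (delta_mx i 0).
Proof.
rewrite {1}[X]dyad_sum linear_sum; apply: eq_bigr => i _.
by rewrite linear_sum; apply: eq_bigr => j _; rewrite linearZ /= jadj_dyad.
Qed.

Lemma addr_jadj X : X + jadj X =
  \sum_i \sum_j X i j *: sdyad (delta_mx i 0) (J *m delta_mx j 0).
Proof.
rewrite {1}[X]dyad_sum jadj_sum -big_split; apply: eq_bigr => i _ /=.
by rewrite -big_split; apply: eq_bigr => j _ /=; rewrite -scalerDr.
Qed.

Lemma subr_jadj X : X - jadj X =
  \sum_i \sum_j X i j *: adyad (delta_mx i 0) (J *m delta_mx j 0).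
Proof.
rewrite {1}[X]dyad_sum jadj_sum -sumrB; apply: eq_bigr => i _ /=.
by rewrite -sumrB; apply: eq_bigr => j _ /=; rewrite -scalerBr.
Qed.

(** Polarization yields every [sdyad u v], and X in [jsym 1] is half of [X + jadj X], which expands
    into such terms. *)
Lemma jsym_span (U : {vspace M}) : (forall u, dyad u u \in U) -> (jsym 1 <= U)%VS.
Proof.
move=> dU; have sU u v : sdyad u v \in U.
  have -> : sdyad u v = dyad (u + v) (u + v) - dyad u u - dyad v v.
    rewrite dyadDl !dyadDr /sdyad; apply/esym/eqP; rewrite !subr_eq; apply/eqP.
    by rewrite [RHS]addrC !addrA.
  by rewrite !memvB.
apply/subvP=> X XS; have EX := jsymP _ _ XS.
have {EX} EX : X = 2^-1 *: (X + jadj X).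
  by rewrite EX scale1r -mulr2n -scaler_nat scalerA mulVf ?scale1r // pnatr_eq0.
rewrite {}EX addr_jadj memvZ //.
by apply/memv_suml => i _; apply/memv_suml => j _; apply/memvZ/sU.
Qed.

Lemma jform_common (u v : V) : u != 0 -> v != 0 ->
  exists w, jform w u != 0 /\ jform w v != 0.
Proof.
move=> /jform_nondeg[w wu] /jform_nondeg[z zv].
have [wv|wv] := eqVneq (jform w v) 0; last by exists w.
have [zu|zu] := eqVneq (jform z u) 0; last by exists z.
by exists (w + z); rewrite !jformDl wv zu addr0 add0r.
Qed.

Lemma jform_quad0 X : X \in jsym 1 -> (forall u, jform u (X *m u) = 0) -> X = 0.
Proof.
move=> /jsymP EX q0; have q u v : jform u (X *m v) = 0.
  have := q0 (u + v); rewrite mulmxDr jformDl !jformDr !q0 add0r addr0.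
  rewrite [jform v _]jform_mul EX scale1r [jform (X *m v) u]jformC opprK -mulr2n => /eqP.
  by rewrite mulrn_eq0 /= => /eqP.
apply/matrixP=> i j; have := q (J *m delta_mx i 0) (delta_mx j 0).
by rewrite jform_delta -colE !mxE.
Qed.

(* An ideal containing X contains [dyad u u] whenever [jform u (X u) != 0];
   applied to X = [dyad v v] this propagates from one v to all of them. *)
Lemma jsym_simple : (0 < n)%N -> simple_lie (jsym 1).
Proof.
move=> n0; split; first exact: jsym_subalg.
  have [i _] : exists i : 'I_n, true by exists (Ordinal n0).
  pose u : V := delta_mx i 0.
  have u0 : u != 0.
    by apply/eqP => /matrixP/(_ i 0)/eqP; rewrite !mxE !eqxx oner_eq0.
  have [v vu] := jform_nondeg u0.
  exists (dyad v v), (dyad u u); split; rewrite ?dyad_jsym //.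
  apply: contraTneq vu => /(congr1 (mulmx^~ u)).
  rewrite /comm !dyadM mul0mx mulmxBl -!scalemxAl !dyad_app jform_self scale0r.
  rewrite scaler0 sub0r [jform u v]jformC scaleNr opprK scalerA => /eqP.
  by rewrite scaler_eq0 (negPf u0) orbF mulf_eq0 orbb negbK.
move=> I sI stI; have [I0|I0] := eqVneq I 0%VS; [by left | right].
have dyadI u X : X \in I -> jform u (X *m u) != 0 -> dyad u u \in I.
  move=> XI q; have := stI _ _ (dyad_jsym u) (stI _ _ (dyad_jsym u) XI).
  rewrite comm_dyad_sq ?(subvP sI) // => /(memvZ (- jform u (X *m u) *+ 2)^-1).
  by rewrite scalerA mulVf ?scale1r // mulrn_eq0 oppr_eq0.
have dyad_step u v : dyad v v \in I -> jform v u != 0 -> dyad u u \in I.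
  move=> vI vu; apply: dyadI vI _; rewrite dyad_app jformZr.
  by rewrite [jform u v]jformC mulrN oppr_eq0 mulf_neq0.
have [v vI v0] : exists2 v, dyad v v \in I & v != 0.
  have XI := memv_pick I; have X0 : vpick I != 0 by rewrite vpick0.
  have /existsNP[u /eqP qu] : ~ forall u, jform u (vpick I *m u) = 0.
    by move=> /(jform_quad0 (subvP sI _ XI)) /eqP; exact/negP.
  exists u; first exact: dyadI XI qu.
  by apply: contraNneq qu => ->; rewrite mulmx0 jform0r.
apply/eqP; rewrite eqEsubv sI /=; apply: jsym_span => u.
have [->|u0] := eqVneq u 0; first by rewrite /dyad !mul0mx mem0v.
(* [u] and [v] may be orthogonal; a vector that pairs nontrivially with both allows the passage in
   two steps. *)
have [w [wu wv]] := jform_common u0 v0.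
by apply: (dyad_step u w _ wu); apply: (dyad_step w v vI); rewrite jformC oppr_eq0.
Qed.

Lemma adyadDl u v w : adyad (u + v) w = adyad u w + adyad v w.
Proof. by rewrite /adyad dyadDl dyadDr opprD addrACA. Qed.
Lemma adyadC u v : adyad v u = - adyad u v.
Proof. by rewrite /adyad opprB. Qed.
Lemma adyadDr u v w : adyad w (u + v) = adyad w u + adyad w v.
Proof. by rewrite ![adyad w _]adyadC adyadDl opprD. Qed.
Lemma adyadZl a u w : adyad (a *: u) w = a *: adyad u w.
Proof. by rewrite /adyad dyadZl dyadZr -scalerBr. Qed.
Lemma adyadNr u w : adyad w (- u) = - adyad w u.
Proof. by rewrite ![adyad w _]adyadC -[- u]scaleN1r adyadZl scaleN1r. Qed.
Lemma adyad_app u v w :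
  adyad u v *m w = jform v w *: u - jform u w *: v.
Proof. by rewrite mulmxBl !dyad_app. Qed.

Lemma mxtrace_adyad u v : \tr (adyad u v) = - jform u v *+ 2.
Proof.
have tr_dyad a b : \tr (dyad a b) = jform b a.
  by rewrite /dyad -mulmxA mxtrace_mulC jformE mxtrace_scalar mulr1n.
by rewrite linearB /= !tr_dyad [jform v u]jformC mulr2n.
Qed.

Definition jskew0 : {vspace M} :=
  (jsym (-1) :&: lker (linfun (mxtrace : M -> K^o)))%VS.

Lemma jskew0P X : reflect (jadj X = - X /\ \tr X = 0) (X \in jskew0).
Proof.
rewrite memv_cap memv_ker lfunE /=.
by apply: (iffP andP) => [[/jsymP-> /eqP->]|[EX ->]]; rewrite ?scaleN1r //;
   split=> //; apply/jsymP; rewrite scaleN1r.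
Qed.

Lemma adyad_jskew0 u v : jform u v = 0 -> adyad u v \in jskew0.
Proof.
move=> uv; rewrite memv_cap adyad_jsym memv_ker lfunE /= mxtrace_adyad uv.
by rewrite mulNrn mul0rn oppr0.
Qed.

Lemma jskew0_stable : stable (jsym 1) jskew0.
Proof.
move=> X Y hX /memv_capP[hY _]; apply/memv_capP; split.
  exact: jsym_stable hX hY.
by rewrite memv_ker lfunE /= /comm linearB /= mxtrace_mulC subrr.
Qed.

(** The pairs [(J e_i, e_j)] with i != j kill the off-diagonal entries, and the pairs
    [(J e_i + J e_j, e_i - e_j)] make the diagonal entries equal. So X is scalar, and the trace
    kills it. *)
Lemma jform_isotropic0 X : \tr X = 0 ->
  (forall u v, jform u v = 0 -> jform u (X *m v) = 0) -> X = 0.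
Proof.
move=> trX H; have Xe i j : jform (J *m delta_mx i 0) (X *m delta_mx j 0) = X i j.
  by rewrite jform_delta -colE mxE.
have Ed i j : jform (J *m delta_mx i 0) (delta_mx j 0) = (i == j)%:R.
  by rewrite jform_delta mxE andbT.
have Xoff i j : i != j -> X i j = 0.
  by move=> ij; rewrite -Xe H // Ed (negPf ij).
have Xdiag i j : X i i = X j j.
  have [->//|ij] := eqVneq i j.
  have : jform (J *m delta_mx i 0 + J *m delta_mx j 0)
               (X *m (delta_mx i 0 - delta_mx j 0)) = 0.
    apply: H; rewrite jformDl !jformDr !jformNr !Ed !eqxx (negPf ij) eq_sym.
    by rewrite (negPf ij) oppr0 addr0 add0r subrr.
  rewrite mulmxBr jformDl !jformDr !jformNr !Xe (Xoff i j) // (Xoff j i) 1?eq_sym //.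
  by rewrite oppr0 addr0 add0r => /eqP; rewrite subr_eq0 => /eqP.
apply/matrixP=> i j; rewrite mxE; have [<-|/Xoff//] := eqVneq i j.
move: trX; rewrite /mxtrace (eq_bigr (fun=> X i i)) ?sumr_const; last by move=> k _.
rewrite card_ord => /eqP; rewrite mulrn_eq0 => /orP[/eqP n0|/eqP//].
by case: i => i /= iln; exfalso; rewrite n0 in iln.
Qed.

(** Two linear conditions have a nonzero solution in dimension above 2. This is how [l >= 2] enters
    the irreducibility: for n = 2 the space [jskew0] is zero. *)
Lemma jform_perp2 (u v : V) : (2 < n)%N ->
  exists2 p : V, p != 0 & jform u p = 0 /\ jform v p = 0.
Proof.
move=> n2; pose B : 'M[K]_(n, 1 + 1) := row_mx (u^T *m J)^T (v^T *m J)^T.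
have kB : kermx B != 0.
  rewrite -mxrank_eq0 mxrank_ker -lt0n subn_gt0.
  exact: leq_ltn_trans (rank_leq_col B) n2.
exists (nz_row (kermx B))^T; first by rewrite -trmx0 (inj_eq (@trmx_inj _ _ _)) nz_row_eq0.
have: nz_row (kermx B) *m B = 0 by apply/sub_kermxP/nz_row_sub.
rewrite mul_mx_row => /(congr1 (fun A : 'M[K]_(1, 1 + 1) => (lsubmx A, rsubmx A))).
rewrite row_mxKl row_mxKr !linear0 => -[E1 E2].
by split; rewrite /jform -[_ *m _ *m _]tr11 trmx_mul trmxK ?E1 ?E2 mxE.
Qed.

(* By [comm_dyad2], for an isotropic pair (u, v) either [adyad u v] lies in W or
   W is orthogonal to it; a vector space not being the union of two proper
   subspaces, for fixed u the same alternative holds for all v at once. *)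
Lemma jskew0_irr : (2 < n)%N -> mod_irr (jsym 1) jskew0.
Proof.
move=> n2; split; [|exact: jskew0_stable|move=> W sW stW].
  pose u : V := delta_mx (Ordinal (ltnW (ltnW n2))) 0.
  have [|v vu] := @jform_nondeg u.
    apply/eqP => /matrixP/(_ (Ordinal (ltnW (ltnW n2))) 0)/eqP.
    by rewrite !mxE !eqxx oner_eq0.
  have [p p0 [up vp]] := jform_perp2 u v n2.
  move=> U0; have := adyad_jskew0 up; rewrite U0 memv0 => /eqP.
  move=> /(congr1 (mulmx^~ v)); rewrite mul0mx adyad_app [jform p v]jformC vp.
  rewrite oppr0 scale0r sub0r => /eqP; rewrite oppr_eq0 scaler_eq0 (negPf p0) orbF.
  by rewrite jformC oppr_eq0 (negPf vu).
have [W0|W0] := eqVneq W 0%VS; [by left | right].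
have key X u v : X \in W -> jform u v = 0 -> jform u (X *m v) != 0 -> adyad u v \in W.
  move=> XW uv q; have := stW _ _ (dyad_jsym u) (stW _ _ (dyad_jsym v) XW).
  have /(subvP sW) := XW; rewrite memv_cap => /andP[XS _].
  rewrite (comm_dyad2 XS) ?mulrNN ?mulr1 // => /(memvZ (- jform u (X *m v))^-1).
  by rewrite scalerA mulVf ?oppr_eq0 // scale1r scaleN1r.
have ex X : X \in W -> X != 0 -> exists u v, jform u v = 0 /\ jform u (X *m v) != 0.
  move=> XW X0; apply: contrapT => nex; case/eqP: X0.
  have /jskew0P[_ trX] := subvP sW _ XW; apply: jform_isotropic0 trX _ => u v uv.
  by apply/eqP; apply: contrapT => /negP q; apply: nex; exists u, v.
pose A u := forall v, jform u v = 0 -> adyad u v \in W.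
pose B u := forall X v, X \in W -> jform u v = 0 -> jform u (X *m v) = 0.
have AB u : A u \/ B u.
  apply: contrapT => /not_orP[/existsNP[v /not_implyP[uv /negP nv]]].
  move=> /existsNP[X /existsNP[w /not_implyP[XW /not_implyP[uw /eqP q]]]].
  have uX : jform u (X *m v) = 0.
    by apply/eqP; apply: contraNT nv; exact: key XW uv.
  have := key X u (v + w) XW; rewrite jformDr uv uw addr0 mulmxDr jformDr uX add0r.
  move=> /(_ erefl q); rewrite adyadDr => h; case/negP: nv.
  by rewrite -(addrK (adyad u w) (adyad u v)) memvB // (key X).
(* The nonzero Y = [adyad u v] of W pairs nontrivially with some isotropic (p, q), so [adyad p q]
   lies in W. The pairing is symmetric up to sign, [J(v, adyad p q u) = - J(p, Y q)], so [B v] would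
   make it vanish. *)
have step u v : A u -> jform u v = 0 -> adyad u v != 0 -> A v.
  move=> Au uv Y0; have [//|Bv] := AB v.
  have YW := Au v uv; have [p [q [pq nz]]] := ex _ YW Y0.
  have := Bv _ u (key _ _ _ YW pq nz); rewrite [jform v u]jformC uv oppr0 => /(_ erefl).
  rewrite adyad_app jformDr jformNr !jformZr => E; case/eqP: nz.
  rewrite adyad_app jformDr jformNr !jformZr; apply/eqP; rewrite -oppr_eq0 -[0]E.
  by rewrite [jform q u]jformC [jform v p]jformC; apply/eqP; ring.
have [v0 v00 Av0] : exists2 v, v != 0 & A v.
  have [p [q [pq nz]]] := ex _ (memv_pick W) ltac:(by rewrite vpick0).
  exists p; last by have [//|/(_ _ q (memv_pick W) pq)/eqP] := AB p; rewrite (negPf nz).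
  by apply: contraNneq nz => ->; rewrite -(scale0r 0) jformZl mul0r.
have Aall u : A u.
  have [->|u0] := eqVneq u 0.
    by move=> v _; rewrite -(scale0r 0) adyadZl scale0r mem0v.
  (* A vector orthogonal to [v0] is reached in one step, unless it is a multiple of [v0]; any other
     goes through some p orthogonal to both [v0] and u. *)
  have [uv|uv] := eqVneq (jform v0 u) 0.
    have [y0|/(step _ _ Av0 uv)//] := eqVneq (adyad v0 u) 0.
    have [w wv] := jform_nondeg v00.
    move: (congr1 (mulmx^~ w) y0); rewrite mul0mx adyad_app => /eqP.
    rewrite subr_eq0 eq_sym => /eqP/(congr1 (GRing.scale (jform v0 w)^-1)).
    have vw : jform v0 w != 0 by rewrite jformC oppr_eq0.
    rewrite !scalerA mulVf // scale1r => -> v; rewrite jformZl => /eqP.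
    rewrite mulf_eq0; case/orP=> [/eqP->|/eqP vv]; rewrite adyadZl ?scale0r ?mem0v //.
    exact/memvZ/Av0.
  have [p p0 [vp up]] := jform_perp2 v0 u n2.
  have Ap : A p.
    apply: step Av0 vp _; apply: contra_neq p0 => /(congr1 (mulmx^~ u)).
    rewrite mul0mx adyad_app [jform p u]jformC up oppr0 scale0r sub0r => /eqP.
    by rewrite oppr_eq0 scaler_eq0 (negPf uv) => /eqP.
  apply: step Ap _ _; first by rewrite jformC up oppr0.
  apply: contra_neq p0 => /(congr1 (mulmx^~ v0)).
  rewrite mul0mx adyad_app [jform p v0]jformC vp oppr0 scale0r subr0 => /eqP.
  by rewrite scaler_eq0 jformC oppr_eq0 (negPf uv) => /eqP.
apply/eqP; rewrite eqEsubv sW /=; apply/subvP=> X /jskew0P[EX trX].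
(* The pair [(e_i, J e_i)] is not isotropic and [T i] has nonzero trace, so only the differences
   [T i - T j] can lie in W. The vanishing trace of X is what allows each [T i] to be replaced by
   [T i - T i0]. *)
pose T i := adyad (delta_mx i 0) (J *m delta_mx i 0).
have Ed i j : jform (delta_mx i 0) (J *m delta_mx j 0) = - (i == j)%:R.
  by rewrite jformC jform_delta mxE andbT eq_sym.
have offW i j : i != j -> adyad (delta_mx i 0) (J *m delta_mx j 0) \in W.
  by move=> ij; apply: Aall; rewrite Ed (negPf ij) oppr0.
have TW i j : T i - T j \in W.
  have [->|ij] := eqVneq i j; first by rewrite subrr mem0v.
  have := Aall (delta_mx i 0 + delta_mx j 0) (J *m (delta_mx i 0 - delta_mx j 0)).
  rewrite mulmxBr jformDl !jformDr !jformNr !Ed !eqxx (negPf ij) eq_sym (negPf ij).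
  rewrite !mulr0n !mulr1n oppr0 subr0 sub0r opprK addNr => /(_ erefl).
  rewrite adyadDl !adyadDr !adyadNr -/(T i) -/(T j).
  set a := adyad _ _; set b := adyad _ _ => h.
  have abW : a - b \in W by rewrite memvB ?offW // eq_sym.
  by have := memvD h abW; rewrite [_ + (a - b)]addrACA subrK [b - _ - _]addrAC subrr sub0r.
have {EX} -> : X = 2^-1 *: (X - jadj X).
  by rewrite EX opprK -mulr2n -scaler_nat scalerA mulVf ?scale1r // pnatr_eq0.
rewrite subr_jadj; apply: memvZ; pose i0 := Ordinal (ltnW (ltnW n2)).
have -> : \sum_i \sum_j X i j *: adyad (delta_mx i 0) (J *m delta_mx j 0) =
    \sum_i (\sum_j X i j *: adyad (delta_mx i 0) (J *m delta_mx j 0) - X i i *: T i0).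
  by rewrite sumrB -scaler_suml -[\sum_i X i i]/(\tr X) trX scale0r subr0.
apply: memv_suml => i _; rewrite (bigD1 i) //= addrAC -scalerBr memvD ?memvZ //.
  exact: TW.
by apply: memv_suml => j ji; apply/memvZ/offW; rewrite eq_sym.
Qed.

End Involution.

(** * Dimensions and Killing forms as traces *)

(** The trace of F on L equals that of F o p on the whole matrix space, p being a projector onto L.
    This trades an unknown basis of L for the matrix units. *)
Lemma subspace_trace (K : fieldType) m (L : {vspace 'M[K]_m})
    (p F : {linear 'M[K]_m -> 'M[K]_m}) :
    (forall x, p x \in L) -> {in L, forall x, p x = x} ->
    {in L, forall x, F x \in L} ->
  \sum_(i < \dim L) coord (vbasis L) i (F (vbasis L)`_i) =
  \sum_i \sum_j F (p (delta_mx i j)) i j.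
Proof.
move=> pL pid FL; pose b := vbasis L.
transitivity (\sum_(k < \dim L) \sum_i \sum_j
    coord b k (p (delta_mx i j)) * F b`_k i j).
  apply: eq_bigr => k _.
  have FbL : F b`_k \in L by rewrite FL // vbasis_mem // mem_nth // size_tuple.
  rewrite -/b -{1}(pid _ FbL) {1}[F b`_k]matrix_sum_delta !linear_sum.
  apply: eq_bigr => i _; rewrite !linear_sum; apply: eq_bigr => j _.
  by rewrite !linearZ /= mulrC.
rewrite exchange_big; apply: eq_bigr => i _; rewrite exchange_big.
apply: eq_bigr => j _; rewrite {2}(coord_vbasis (pL (delta_mx i j))) linear_sum.
by rewrite summxE; apply: eq_bigr => k _; rewrite linearZ mxE.
Qed.

Lemma dim_projector (K : fieldType) m (L : {vspace 'M[K]_m})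
    (p : {linear 'M[K]_m -> 'M[K]_m}) :
    (forall x, p x \in L) -> {in L, forall x, p x = x} ->
  (\dim L)%:R = \sum_i \sum_j p (delta_mx i j) i j.
Proof.
move=> pL pid; rewrite -(subspace_trace (F := idfun) pL pid) //.
rewrite -[\dim L in LHS]card_ord -sum1_card natr_sum.
apply: eq_bigr => k _ /=.
by rewrite coord_free ?eqxx // (basis_free (vbasisP L)).
Qed.

Lemma mxE_delta (K : comRingType) m (A B : 'M[K]_m) i j k l :
  (A *m delta_mx i j *m B) k l = A k i * B j l.
Proof.
rewrite -mulmxA -[delta_mx i j](mul_delta_mx (0 : 'I_1)) !mulmxA -mulmxA.
by rewrite -colE -rowE mxE big_ord1 !mxE.
Qed.

(** The left side is the trace of the operator [Z |-> A Z B]; [sum_delta_tr] is the analogue for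
    [Z |-> A Z^T B]. *)
Lemma sum_delta (K : comRingType) m (A B : 'M[K]_m) :
  \sum_i \sum_j (A *m delta_mx i j *m B) i j = \tr A * \tr B.
Proof.
rewrite /mxtrace mulr_suml; apply: eq_bigr => i _; rewrite mulr_sumr.
by apply: eq_bigr => j _; rewrite mxE_delta.
Qed.

Lemma sum_delta_tr (K : comRingType) m (A B : 'M[K]_m) :
  \sum_i \sum_j (A *m (delta_mx i j)^T *m B) i j = \tr (A *m B^T).
Proof.
rewrite /mxtrace; apply: eq_bigr => i _; rewrite mxE.
by apply: eq_bigr => j _; rewrite trmx_delta mxE_delta mxE.
Qed.

Section Dimensions.
Variables (K : numFieldType) (n : nat) (J : 'M[K]_n).
Hypotheses (JT : J^T = - J) (JJ : J *m J = - 1%:M).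
Local Notation M := 'M[K]_n.

Lemma jadj1 : jadj J 1%:M = - 1%:M.
Proof. by rewrite /jadj trmx1 mulmx1. Qed.

Lemma mxtrace_jadj X : \tr (jadj J X) = - \tr X.
Proof. by rewrite mxtrace_mulC mulmxA JJ mulNmx mul1mx linearN /= mxtrace_tr. Qed.

Lemma mxtrace_jsym1 X : X \in jsym J 1 -> \tr X = 0.
Proof.
move=> /jsymP EX; have /eqP := mxtrace_jadj X.
by rewrite EX scale1r -subr_eq0 opprK -mulr2n mulrn_eq0 /= => /eqP.
Qed.

Lemma sum_jadj_delta (A B : M) :
  \sum_i \sum_j (A *m jadj J (delta_mx i j) *m B) i j = - \tr (A *m jadj J B).
Proof.
transitivity (\sum_i \sum_j ((A *m J) *m (delta_mx i j)^T *m (J *m B)) i j).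
  by apply: eq_bigr => i _; apply: eq_bigr => j _; rewrite /jadj !mulmxA.
by rewrite sum_delta_tr trmx_mul JT !mxN linearN /= /jadj !mulmxA.
Qed.

Lemma halfK (X : M) : 2^-1 *: (X + X) = X.
Proof. by rewrite -mulr2n -scaler_nat scalerA mulVf ?scale1r ?pnatr_eq0. Qed.

Definition skew0_proj (X : M) : M :=
  2^-1 *: (X - jadj J X) - (\tr X / n%:R) *: 1%:M.

Lemma skew0_proj_is_linear : linear skew0_proj.
Proof.
move=> a u v; rewrite /skew0_proj !linearP /=.
move: (jadj J u) (jadj J v) => u' v'; move: (n%:R^-1) (2^-1) => c d.
by apply/matrixP=> i j; rewrite !mxE; ring.
Qed.
HB.instance Definition _ := GRing.isLinear.Build K M M _ skew0_proj skew0_proj_is_linear.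

(** The value [n(n-1)/2 - 1], written without division or subtraction. It is the trace of
    [skew0_proj]: the identity contributes [n^2/2], [jadj] contributes [-n/2], and the removal of
    the scalar part -1. *)
Lemma dim_jskew0 : (0 < n)%N -> ((\dim (jskew0 J)).+1 * 2 + n = n * n)%N.
Proof.
move=> n0; have nR : n%:R != 0 :> K by rewrite pnatr_eq0 -lt0n.
have D : (\dim (jskew0 J))%:R = 2^-1 * (n%:R * n%:R - n%:R) - 1 :> K.
  rewrite (@dim_projector _ _ _ skew0_proj); first last.
  - move=> z /jskew0P[Ez tz]; rewrite /= /skew0_proj Ez opprK halfK tz.
    by rewrite mul0r scale0r subr0.
  - move=> z; apply/jskew0P; rewrite /= /skew0_proj; split.
      rewrite linearB linearZ linearB linearZ /= (jadjK JT JJ) jadj1.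
      by rewrite scalerN opprK opprB -scalerN opprB addrC.
    rewrite linearB linearZ linearB linearZ /= mxtrace_jadj mxtrace1 opprK.
    by rewrite /GRing.scale /= divfK //; field.
  transitivity (2^-1 * (\sum_(i < n) \sum_(j < n) ((1%:M : M) *m delta_mx i j *m 1%:M) i j
      - \sum_(i < n) \sum_(j < n) ((1%:M : M) *m jadj J (delta_mx i j) *m 1%:M) i j)
      - n%:R^-1 * \sum_(i < n) \sum_(j < n) ((delta_mx i j)^T : M) i j).
    rewrite -!sumrB !mulr_sumr -sumrB; apply: eq_bigr => i _.
    rewrite -!sumrB !mulr_sumr -sumrB; apply: eq_bigr => j _.
    rewrite /= /skew0_proj !mul1mx !mulmx1.
    have -> : \tr (delta_mx i j : M) = (i == j)%:R.
      rewrite -[delta_mx i j](mul_delta_mx (0 : 'I_1)) mxtrace_mulC mul_delta_mx_cond.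
      by rewrite /mxtrace big_ord1 eq_sym; case: (_ == _); rewrite ?mulr0n ?mulr1n !mxE.
    move: (jadj _ _) => A; rewrite trmx_delta !mxE !eqxx /= eq_sym.
    have [->|ij] := eqVneq i j; first by rewrite mul1r mulr1n !mulr1.
    by rewrite /= !mul0r !mulr0n !mulr0.
  rewrite sum_delta sum_jadj_delta mul1mx jadj1 linearN /= opprK !mxtrace1.
  suff -> : \sum_(i < n) \sum_(j < n) ((delta_mx i j)^T : M) i j = n%:R by rewrite mulVf.
  rewrite -mxtrace1 /mxtrace; apply: eq_bigr => i _; rewrite (bigD1 i) //= big1.
    by rewrite trmx_delta !mxE eqxx addr0.
  by move=> j ji; rewrite trmx_delta mxE eq_sym (negPf ji).
apply/eqP; rewrite -(eqr_nat K) natrD !natrM -[_.+1]addn1 natrD D subrK.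
by rewrite mulrAC mulVf ?mul1r ?pnatr_eq0 // subrK.
Qed.

Definition sym_proj (X : M) : M := 2^-1 *: (X + jadj J X).

Lemma sym_proj_is_linear : linear sym_proj.
Proof.
move=> a u v; rewrite /sym_proj linearP /= scalerA mulrC -scalerA -scalerDr.
by rewrite [a *: (_ + _)]scalerDr addrACA.
Qed.
HB.instance Definition _ := GRing.isLinear.Build K M M _ sym_proj sym_proj_is_linear.

(** The projector onto [jsym 1] is the mean of the identity and [jadj]. Preceding [ad x ad y], the
    identity gives the trace [2n tr(xy)], as x and y are traceless, and [jadj] gives [4 tr(xy)];
    half the sum yields n + 2. *)
Lemma killing_jsym x y : x \in jsym J 1 -> y \in jsym J 1 ->
  killing (jsym J 1) x y = n.+2%:R * \tr (x *m y).
Proof.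
move=> xS yS; rewrite /killing.
rewrite (subspace_trace (p := sym_proj) (F := comm x \o comm y)); first last.
- by move=> z zS /=; rewrite !(jsym_subalg JJ).
- by move=> z /jsymP Ez; rewrite /= /sym_proj Ez scale1r halfK.
- move=> z /=; apply/jsymP; rewrite /sym_proj linearZ linearD /= (jadjK JT JJ).
  by rewrite scale1r [z + _]addrC.
have F z i j : comm x (comm y z) i j =
    (x *m y *m z *m 1%:M) i j - (x *m z *m y) i j - (y *m z *m x) i j + (1%:M *m z *m (y *m x)) i j.
  rewrite /comm mulmx1 mul1mx mulmxBr mulmxBl !mulmxA.
  move: (x *m y *m z) (x *m z *m y) (y *m z *m x) (z *m y *m x) => a b c d.
  by rewrite !mxE; ring.
transitivity (2^-1 *
   (\sum_i \sum_j comm x (comm y (delta_mx i j)) i j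
    + \sum_i \sum_j comm x (comm y (jadj J (delta_mx i j))) i j)).
  rewrite -big_split mulr_sumr; apply: eq_bigr => i _ /=.
  rewrite -big_split mulr_sumr; apply: eq_bigr => j _ /=.
  rewrite /sym_proj -[comm x (comm y _)]/((comm x \o comm y) _) linearZ linearD /=.
  by move: (comm x _) (comm x _) => A B; rewrite !mxE.
have sumF (f : M -> M) : \sum_i \sum_j comm x (comm y (f (delta_mx i j))) i j
  = \sum_i \sum_j (x *m y *m f (delta_mx i j) *m 1%:M) i j
   - \sum_i \sum_j (x *m f (delta_mx i j) *m y) i j
   - \sum_i \sum_j (y *m f (delta_mx i j) *m x) i j
   + \sum_i \sum_j (1%:M *m f (delta_mx i j) *m (y *m x)) i j.
  rewrite -!sumrB -big_split; apply: eq_bigr => i _ /=.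
  by rewrite -!sumrB -big_split; apply: eq_bigr => j _ /=; rewrite F.
rewrite (sumF id) sumF /= !sum_delta !sum_jadj_delta (jadjM JJ) jadj1.
have /jsymP := xS; have /jsymP := yS; rewrite !scale1r => -> ->.
rewrite (mxtrace_jsym1 xS) (mxtrace_jsym1 yS) mul1mx !mxN !mulmx1 !linearN /= mxtrace1.
by rewrite [\tr (y *m x)]mxtrace_mulC -[n.+2]addn2 natrD; field.
Qed.

End Dimensions.


(** * Cartan subalgebras of the symplectic Lie algebra *)

(** In the binomial expansion of [(f - g)^(a + b)] every term contains [f^a] or [g^b]. As vanishing
    is known at y only, the expansion is run as a double induction that peels off one factor [f - g]
    at a time. *)
Lemma iter_sub_nil (V : zmodType) (f g : {additive V -> V}) a b (y : V) :
    (forall x, f (g x) = g (f x)) -> iter a f y = 0 -> iter b g y = 0 ->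
  iter (a + b) (fun x => f x - g x) y = 0.
Proof.
move=> fg; pose h x := f x - g x; rewrite -/h.
have h0 k : iter k h 0 = 0 by elim: k => //= k ->; rewrite /h !raddf0 ?subrr ?addr0.
have hB k x z : iter k h (x - z) = iter k h x - iter k h z.
  elim: k => //= k ->; rewrite /h !raddfB /=.
  by rewrite -opprB addrACA -opprD opprB.
have fI k x : iter k g (f x) = f (iter k g x) by elim: k => //= k ->; rewrite fg.
have gI k x : iter k f (g x) = g (iter k f x) by elim: k => //= k ->; rewrite fg.
elim: a => [|a IHa] in b y *; first by move=> /= -> _; rewrite h0.
elim: b => [|b IHb] in y * => fy gy; first by rewrite /= in gy; rewrite gy h0.
rewrite addnS iterSr {2}/h hB addSnnS IHa ?sub0r; last 2 first.
- by rewrite -iterSr.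
- by rewrite fI gy raddf0.
rewrite -addSnnS IHb ?oppr0 //; first by rewrite gI fy raddf0.
by rewrite -iterSr.
Qed.

(** * Jordan-Chevalley decomposition *)

Section Jordan.
Variables (K : numClosedFieldType) (n' : nat).
Local Notation n := n'.+1.
Local Notation M := 'M[K]_n.

Lemma crt_XsubC (rs : seq K) k : uniq rs ->
  exists q : {poly K}, forall r, r \in rs -> ('X - r%:P) ^+ k %| q - r%:P.
Proof.
elim: rs => [|a rs IH] /=; first by exists 0.
case/andP=> ars /IH[q Hq]; pose m := \prod_(r <- rs) ('X - r%:P) ^+ k.
have : coprimep (('X - a%:P) ^+ k) m.
  rewrite coprimep_expl // /m big_seq; elim/big_rec: _ => [|r p rrs IHp].
    by rewrite coprimep1.
  rewrite coprimepMr IHp andbT coprimep_expr // coprimep_XsubC root_XsubC.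
  by apply: contraNneq ars => <-.
case/Bezout_eq1_coprimepP=> [[u v] /= uv].
(* By Bezout [v * m] is 1 modulo [(X - a)^k], and it is 0 modulo the other factors: the correction
   only acts at a. *)
exists (q + v * (a%:P - q) * m) => r; rewrite inE; case/predU1P=> [->|rrs].
  have -> : q + v * (a%:P - q) * m - a%:P = (q - a%:P) * u * ('X - a%:P) ^+ k.
    by rewrite -[RHS]mulrA [u * _](canRL (addrK _) uv); ring.
  exact: dvdp_mull.
rewrite addrAC dvdp_add ?Hq // dvdp_mull // /m (big_rem r) //=.
exact: dvdp_mulr.
Qed.

(* Jordan-Chevalley decomposition; the semisimple part is an odd polynomial in X,
   so that it stays in the Lie algebra of a bilinear form. *)
Lemma jordan_odd (X : M) : exists q : {poly K},
  [/\ q \Po - 'X = - q, diagonalizable (horner_mx X q)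
    & (X - horner_mx X q) ^+ n = 0].
Proof.
have [rs0 Ers] := closed_field_poly_normal (char_poly X).
(* The eigenvalues are closed up under negation: then [q0(-X)] is congruent to [- r] at every r, and
   the odd part q of [q0] satisfies the same congruences as [q0]. *)
pose rs := undup (rs0 ++ map -%R rs0).
have rsN r : r \in rs -> - r \in rs.
  rewrite !mem_undup !mem_cat => /orP[h|/mapP[s h ->]]; last by rewrite opprK h.
  by rewrite map_f ?orbT.
have [q0 Hq0] := crt_XsubC n (undup_uniq (rs0 ++ map -%R rs0)).
pose q := 2^-1 *: (q0 - (q0 \Po - 'X)).
have Hq r : r \in rs -> ('X - r%:P) ^+ n %| q - r%:P.
  move=> rrs; have -> : q - r%:P = 2^-1 *: ((q0 - r%:P) - ((q0 \Po - 'X) + r%:P)).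
    rewrite opprD addrACA -opprD -polyCD scalerDr scalerN -mulr2n; congr (_ - _).
    by rewrite -mul_polyC -polyCM -[r *+ 2]mulr_natr mulrC mulfK ?pnatr_eq0.
  rewrite dvdpZr ?invr_eq0 ?pnatr_eq0 // dvdp_sub ?Hq0 //.
  have /(dvdp_comp_poly (- 'X)) := Hq0 _ (rsN _ rrs).
  rewrite rmorphXn /= !comp_polyB comp_polyX !comp_polyC polyCN opprK.
  apply: dvdp_trans; have -> : - 'X + r%:P = - ('X - r%:P) by rewrite opprB addrC.
  by rewrite [X in _ %| X]exprNn dvdp_mull.
pose P := \prod_(r <- rs) ('X - r%:P).
have PX : horner_mx X (P ^+ n) = 0.
  apply/eqP; rewrite -dvd_mxminpoly; apply: dvdp_trans (mxminpoly_dvd_char X) _.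
  have sz : size rs0 = n.
    have := size_char_poly X; rewrite Ers size_scale ?lead_coef_eq0; last first.
      by rewrite -size_poly_eq0 size_char_poly.
    by rewrite size_prod_XsubC => -[].
  rewrite Ers (monicP (char_poly_monic X)) scale1r -sz.
  have : {subset rs0 <= rs} by move=> z zrs; rewrite mem_undup mem_cat zrs.
  elim: (rs0) => [|z s IHs] sub; first by rewrite big_nil expr0 dvdpp.
  rewrite big_cons exprS dvdp_mul ?IHs //; last by move=> y ys; rewrite sub // inE ys orbT.
  by rewrite /P (big_rem z) ?dvdp_mulr // sub ?mem_head.
exists q; split.
- rewrite /q comp_polyZ comp_polyB -comp_polyA [- 'X \Po _]raddfN /= comp_polyX opprK comp_polyXr.
  by rewrite -scalerN opprB.
(* Each [q - r] vanishes to order n at r, so the product over [rs] is a multiple of [P^n], which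
   annihilates X. The roots being distinct, [q(X)] is diagonalizable. *)
- apply/diagonalizableP; exists rs; first exact: undup_uniq.
  apply: mxminpoly_min; rewrite rmorph_prod /=.
  have -> : \prod_(r <- rs) horner_mx (horner_mx X q) ('X - r%:P) =
      horner_mx X (\prod_(r <- rs) (q - r%:P)).
    rewrite rmorph_prod; apply: eq_bigr => r _.
    by rewrite !rmorphB /= horner_mx_X !horner_mx_C.
  suff /dvdpP[u ->] : P ^+ n %| \prod_(r <- rs) (q - r%:P) by rewrite rmorphM /= PX mulr0.
  rewrite /P -prodrXl big_seq [X in _ %| X]big_seq.
  by elim/big_rec2: _ => [|r p1 p2 rrs IHp]; rewrite ?dvdpp // dvdp_mul ?Hq.
have -> : X - horner_mx X q = horner_mx X ('X - q) by rewrite rmorphB /= horner_mx_X.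
rewrite -rmorphXn; suff /dvdpP[u ->] : P ^+ n %| ('X - q) ^+ n by rewrite rmorphM /= PX mulr0.
apply: dvdp_exp2r; apply: uniq_roots_dvdp; last by rewrite uniq_rootsE undup_uniq.
apply/allP => r rrs; rewrite -dvdp_XsubCl.
have -> : 'X - q = ('X - r%:P) - (q - r%:P) by rewrite opprB addrA subrK.
by rewrite dvdp_sub ?dvdpp //; apply: dvdp_trans (Hq _ rrs); rewrite exprS dvdp_mulr.
Qed.

End Jordan.

(** A finite list in S of maximal span. It replaces the set of all torus elements, given by a mere
    predicate, with a finite list that can be diagonalized simultaneously. *)
Lemma span_exhaust (K : fieldType) (U : vectType K) (S : U -> Prop) :
  exists X : seq U, {in X, forall x, S x} /\ forall x, S x -> x \in <<X>>%VS.
Proof.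
pose Q k := exists2 X : seq U, {in X, forall x, S x} & \dim <<X>> = k.
have Q0 : exists k, `[< Q k >] by exists 0; apply/asboolP; exists [::]; rewrite ?span_nil ?dimv0.
have Qub k : `[< Q k >] -> (k <= dim U)%N.
  by move=> /asboolP[X _ <-]; rewrite -dimvf dimvS ?subvf.
case: (ex_maxnP Q0 Qub) => k /asboolP[X Ss Ek] kmax; exists X; split=> // x Sx.
have : (\dim <<x :: X>> <= k)%N.
  apply: kmax; apply/asboolP; exists (x :: X) => // y; rewrite inE.
  by case/predU1P=> [->|/Ss].
rewrite -Ek span_cons => le; have : (<[x]> + <<X>> <= <<X>>)%VS.
  by rewrite -(geq_leqif (dimv_leqif_sup (addvSr _ _))).
by rewrite subv_add => /andP[+ _]; rewrite memvE.
Qed.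

(** * Nilpotent Lie algebras and Engel's theorem *)

Section Nilpotent.
Variables (K : fieldType) (m : nat).
Local Notation M := 'M[K]_m.
Implicit Types (H Z U : {vspace M}).

Lemma commDl (x y z : M) : comm (x + y) z = comm x z + comm y z.
Proof. by rewrite /comm mulmxDl mulmxDr opprD addrACA. Qed.
Lemma commZl a (y z : M) : comm (a *: y) z = a *: comm y z.
Proof. by rewrite ![comm _ z]commC linearZ /= scalerN. Qed.
Lemma comm_self (x : M) : comm x x = 0.
Proof. exact: subrr. Qed.

Lemma conj_comm (P X Y : M) : P \in unitmx ->
  comm (P *m X *m invmx P) (P *m Y *m invmx P) = P *m comm X Y *m invmx P.
Proof.
move=> Pu; rewrite /comm mulmxBr mulmxBl !mulmxA.
by rewrite !(mulmxKV Pu).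
Qed.

Lemma comm_diag (d : 'rV[K]_m) (Y : M) i j :
  comm (diag_mx d) (Y : M) i j = (d 0 i - d 0 j) * Y i j.
Proof.
by rewrite /comm mul_diag_mx mul_mx_diag !mxE [Y i j * _]mulrC -mulrBl.
Qed.

Lemma comm_span (X : seq M) U (z : M) : {in X, forall c, comm c z \in U} ->
  {in <<X>>%VS, forall c, comm c z \in U}.
Proof.
move=> sU; pose ad := linfun (comm z).
have : (<<X>> <= ad @^-1: U)%VS.
  by apply/span_subvP=> c cs; rewrite -memv_preim lfunE /= commC memvN sU.
by move=> /subvP sub c /sub; rewrite -memv_preim lfunE /= commC memvN.
Qed.

Lemma mem_lie_prod H U (x y : M) : x \in H -> y \in U -> comm x y \in lie_prod H U.
Proof.
move=> xH yU; rewrite -[H](span_basis (vbasisP H)) in xH.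
apply: comm_span xH => c cH; rewrite commC memvN.
rewrite -[U](span_basis (vbasisP U)) in yU.
apply: comm_span yU => d dU; rewrite commC memvN.
by apply: memv_span; apply/allpairsP; exists (c, d).
Qed.

Section Central.
Variable H : {vspace M}.
Hypothesis Hsub : lie_subalg H.
Let C k := iter k (lie_prod H) H.

Lemma central_sub k : (C k <= H)%VS.
Proof.
elim: k => [|k IHk] /=; first exact: subvv.
apply/span_subvP=> _ /allpairsP[[x y] [/= xH yC ->]].
by rewrite Hsub ?(vbasis_mem xH) // (subvP IHk) ?(vbasis_mem yC).
Qed.

Lemma central_step k x y : x \in H -> y \in C k -> comm x y \in C k.+1.
Proof. exact: mem_lie_prod. Qed.

Lemma iter_central k x y : x \in H -> y \in H -> iter k (comm x) y \in C k.
Proof. by move=> xH yH; elim: k => //= k IHk; apply: mem_lie_prod. Qed.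

(* Engel's theorem for H acting on Z / H, by descending induction along the
   lower central series: modulo H, the elements of one term commute on the
   vectors killed by the next. *)
Lemma normalizer_grows Z : nilpotent_lie H -> stable H Z ->
    {in H & Z, forall x z, exists k, iter k (comm x) z \in H} ->
    ~~ (Z <= H)%VS ->
  exists z, [/\ z \in Z, z \notin H & {in H, forall x, comm x z \in H}].
Proof.
move=> [N CN] stZ nil /subvPn[z0 z0Z z0H].
(* [Q N] holds for any vector of Z outside H because [C N = 0], and [Q 0] is the conclusion because
   [C 0 = H]. *)
pose Q k := exists z, [/\ z \in Z, z \notin H & {in C k, forall x, comm x z \in H}].
suff QS k : Q k.+1 -> Q k.
  have QN : Q N.
    exists z0; split=> // x; rewrite [C N]CN memv0 => /eqP->.
    by rewrite /comm mul0mx mulmx0 subrr mem0v.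
  by elim: N QN {CN} => [|N IHN] // /QS.
case=> z [zZ zH Az].
suff main (s : seq M) : {subset s <= C k} -> exists w,
    [/\ w \in Z /\ {in C k.+1, forall x, comm x w \in H}, w \notin H
      & {in s, forall x, comm x w \in H}].
  have [|w [[wZ _] wH Hw]] := main (vbasis (C k)); first by move=> x; apply: vbasis_mem.
  by exists w; split=> //; rewrite -[C k](span_basis (vbasisP _)); apply: comm_span.
(* For each further element c the vector is replaced by its last iterate under [comm c] before H is
   reached; the properties gained so far survive. *)
elim: s => [|c s IHs] sC; first by exists z.
have [|w [[wZ Aw] wH Hw]] := IHs; first by move=> x xs; rewrite sC // inE xs orbT.
have cC : c \in C k by rewrite sC ?mem_head.
have cH := subvP (central_sub k) _ cC.
pose A w := w \in Z /\ {in C k.+1, forall x, comm x w \in H}.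
have Astep v : A v -> A (comm c v).
  case=> vZ Av; split=> [|x xC]; first exact: stZ.
  rewrite comm_jacobi memvD ?Av //; last by rewrite Hsub ?Av.
  by apply: central_step cC; apply: subvP (central_sub k.+1) _ xC.
have Sstep v : A v -> {in s, forall x, comm x v \in H} -> {in s, forall x, comm x (comm c v) \in H}.
  move=> [vZ Av] Sv x xs; rewrite comm_jacobi memvD //; last by rewrite Hsub ?Sv.
  apply: Av; apply: central_step cC; apply: subvP (central_sub k) _ _.
  by rewrite sC // inE xs orbT.
have it j : A (iter j (comm c) w) /\ {in s, forall x, comm x (iter j (comm c) w) \in H}.
  elim: j => [|j [IA IS]] //=; split; [exact: Astep | exact: Sstep].
have ex := nil c w cH wZ; case: (ex_minnP ex) => -[|j] jH jmin; first by rewrite (negPf wH) in jH.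
have [Aj Sj] := it j; exists (iter j (comm c) w); split=> //.
  by apply/negP => /jmin; rewrite ltnn.
by move=> x; rewrite inE => /predU1P[->|/Sj].
Qed.

Lemma no_eigen c x y : nilpotent_lie H -> x \in H -> y \in H ->
  comm x y = c *: y -> c != 0 -> y = 0.
Proof.
move=> [N CN] xH yH xy c0; have := iter_central N xH yH; rewrite [C N]CN memv0.
have -> : iter N (comm x) y = c ^+ N *: y.
  elim: (N) => [|k IHk] /=; first by rewrite expr0 scale1r.
  by rewrite IHk linearZ /= xy scalerA exprSr.
by rewrite scaler_eq0 expf_eq0 (negPf c0) andbF => /eqP.
Qed.

End Central.
End Nilpotent.

Section Semisimple.
Variables (K : numClosedFieldType) (n' : nat).
Local Notation n := n'.+1.
Local Notation M := 'M[K]_n.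
Implicit Types (X Y s : M).

Lemma diagonalizable_exP s : diagonalizable s ->
  exists (P : M) (d : 'rV[K]_n), P \in unitmx /\ s = P *m diag_mx d *m invmx P.
Proof.
case=> Q Qu /(diagonalizable_forLR Qu)[d ->]; exists (invmx Q), d.
by rewrite unitmx_inv mxpoly.conjumx ?unitmx_inv.
Qed.

Lemma anticomm_diag (d : 'rV[K]_n) Y i j :
  (Y *m diag_mx d + diag_mx d *m Y) i j = (d 0 i + d 0 j) * Y i j.
Proof.
by rewrite mul_diag_mx mul_mx_diag !mxE [Y i j * _]mulrC -mulrDl addrC.
Qed.

(** [ad s] is diagonalizable along with s: in an eigenbasis it multiplies the entry (i, j) by
    [d_i - d_j]. So a power of it has no larger kernel. *)
Lemma comm_iter_diagonalizable s Y k : diagonalizable s ->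
  iter k (comm s) Y = 0 -> comm s Y = 0.
Proof.
move=> /diagonalizable_exP[P [d [Pu ->]]].
pose Z := invmx P *m Y *m P; have -> : Y = P *m Z *m invmx P.
  by rewrite /Z !mulmxA mulmxV // mul1mx mulmxK.
rewrite conj_comm // => E.
suff -> : comm (diag_mx d) Z = 0 by rewrite mulmx0 mul0mx.
have itE j : iter j (comm (P *m diag_mx d *m invmx P)) (P *m Z *m invmx P) =
    P *m iter j (comm (diag_mx d)) Z *m invmx P.
  by elim: j => //= j ->; rewrite conj_comm.
have {E itE} Zk : iter k (comm (diag_mx d)) Z = 0.
  rewrite itE in E; move: (congr1 (fun A => invmx P *m A *m P) E).
  by rewrite mulmx0 mul0mx !mulmxA mulVmx // mul1mx mulmxKV.
apply/matrixP=> i j; rewrite comm_diag [RHS]mxE.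
have itE : iter k (comm (diag_mx d)) Z i j = (d 0 i - d 0 j) ^+ k * Z i j.
  elim: (k) => [|l IHl] /=; first by rewrite expr0 mul1r.
  by rewrite comm_diag IHl mulrA -exprS.
move: itE; rewrite Zk mxE => /esym/eqP; rewrite mulf_eq0 expf_eq0 => /orP[/andP[_]|].
  by move=> /eqP->; rewrite mul0r.
by move=> /eqP->; rewrite mulr0.
Qed.

Lemma comm_nilp X Y k : X ^+ k = 0 -> iter (k + k) (comm X) Y = 0.
Proof.
move=> Xk; have it j Z : iter j (mulmx X) Z = X ^+ j *m Z.
  elim: j => [|j IHj] /=; first by rewrite expr0 mul1mx.
  by rewrite IHj exprS mulmxA.
have itr j Z : iter j (mulmxr X) Z = Z *m X ^+ j.
  elim: j => [|j IHj] /=; first by rewrite expr0 mulmx1.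
  by rewrite IHj exprSr mulmxA.
apply: (@iter_sub_nil _ (mulmx X) (mulmxr X)); rewrite ?it ?itr ?Xk ?mul0mx ?mulmx0 //.
by move=> Z /=; rewrite mulmxA.
Qed.

End Semisimple.

(** * Structure of an arbitrary Cartan subalgebra *)

Section Cartan.
Variables (K : numClosedFieldType) (n' : nat) (J : 'M[K]_n'.+1).
Hypotheses (JT : J^T = - J) (JJ : J *m J = - 1%:M).
Local Notation n := n'.+1.
Local Notation M := 'M[K]_n.
Local Notation L := (jsym J 1).
Local Notation sdyadJ := (sdyad J).
Local Notation jformJ := (jform J).
Implicit Types (X Y s : M).

Lemma sdyadDl u v w : sdyadJ (u + v) w = sdyadJ u w + sdyadJ v w.
Proof. by rewrite /sdyad dyadDl dyadDr addrACA. Qed.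
Lemma sdyadC u v : sdyadJ v u = sdyadJ u v.
Proof. by rewrite /sdyad addrC. Qed.
Lemma sdyadZl a u v : sdyadJ (a *: u) v = a *: sdyadJ u v.
Proof. by rewrite /sdyad dyadZl dyadZr -scalerDr. Qed.
Lemma sdyadZr a u v : sdyadJ u (a *: v) = a *: sdyadJ u v.
Proof. by rewrite sdyadC sdyadZl sdyadC. Qed.
Lemma sdyad_app u v w : sdyadJ u v *m w = jformJ v w *: u + jformJ u w *: v.
Proof. by rewrite /sdyad mulmxDl !dyad_app. Qed.

(** The map [- jadj J] reverses products and sends this X to [-X], hence [p(X)] to [p(-X)]. For odd
    p, [p(X)] therefore stays in [jsym 1]. *)
Lemma jadj_horner X p : jadj J X = X ->
  jadj J (horner_mx X p) = - horner_mx X (p \Po - 'X).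
Proof.
move=> EX; elim/poly_ind: p => [|p c IHp].
  by rewrite comp_poly0 !rmorph0 linear0 oppr0.
rewrite comp_poly_MXaddC mulrN !rmorphD rmorphM rmorphN rmorphM /=.
rewrite horner_mx_X !horner_mx_C -[c%:M]scalemx1 linearD linearZ /= jadj1 //.
rewrite -!mulmxE (jadjM JJ) IHp EX mulmxN opprK scalerN opprD opprK.
by congr (_ - _); apply/comm_mx_horner/comm_mx_refl.
Qed.

Lemma sdyad_eq0 u v : sdyadJ u v = 0 -> u = 0 \/ v = 0.
Proof.
move=> s0; have [->|v0] := eqVneq v 0; [by right | left].
have app w : jformJ v w *: u + jformJ u w *: v = 0.
  by rewrite -!dyad_app -mulmxDl -[_ + _]/(sdyadJ u v) s0 mul0mx.
have uv : jformJ u v = 0.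
  move: (app v); rewrite (jform_self JT) scale0r add0r => /eqP.
  by rewrite scaler_eq0 (negPf v0) orbF => /eqP.
have [w] := jform_nondeg JT JJ v0; rewrite (jformC JT) oppr_eq0 => vw.
have := app w; move/(congr1 (GRing.scale (jformJ v w)^-1)).
rewrite scaler0 scalerDr !scalerA mulVf // scale1r => /eqP; rewrite addr_eq0 => /eqP Eu.
set c := _ * _ in Eu; have := s0; rewrite Eu -scaleNr /sdyad dyadZl dyadZr.
rewrite -scalerDr => /eqP; rewrite scaler_eq0 oppr_eq0 => /orP[/eqP->|].
  by rewrite oppr0 scale0r.
rewrite -mulr2n -scaler_nat scaler_eq0 pnatr_eq0 /= => /eqP /(dyad_eq0 JT JJ)[];
  by move/eqP; rewrite (negPf v0).
Qed.

Section Subalgebra.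
Variable H : {vspace M}.
Hypothesis cH : cartan_subalg L H.

Let HL : (H <= L)%VS. Proof. by case: cH. Qed.
Let Hsub : lie_subalg H. Proof. by case: cH. Qed.
Let Hnil : nilpotent_lie H. Proof. by case: cH. Qed.
Let Hnorm x : x \in L -> {in H, forall y, comm y x \in H} -> x \in H.
Proof. by case: cH => _ _ _ h xL xH; apply: h => // y yH; rewrite commC memvN xH. Qed.

Definition torus_elt s := [/\ s \in L, diagonalizable s & {in H, forall y, comm s y = 0}].

Lemma torus_elt_mem s : torus_elt s -> s \in H.
Proof.
by case=> sL _ sC; apply: Hnorm => // y yH; rewrite commC sC // oppr0 mem0v.
Qed.

(** On H, [ad x] is nilpotent because H is; [ad (x - s)] is nilpotent everywhere and commutes with
    it. So their difference [ad s] is nilpotent on H; being also diagonalizable, it vanishes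
    there. *)
Lemma cartan_jordan x : x \in H -> exists s, torus_elt s /\ (x - s) ^+ n = 0.
Proof.
move=> xH; have [q [qodd sd xs]] := jordan_odd x.
exists (horner_mx x q); split=> //; set s := horner_mx x q in sd xs *.
have /jsymP Ex := subvP HL _ xH; rewrite scale1r in Ex.
split=> //.
  by apply/jsymP; rewrite scale1r jadj_horner // qodd rmorphN opprK.
move=> y yH; have [N CN] := Hnil.
have xN : iter N (comm x) y = 0.
  by have := iter_central N xH yH; rewrite CN memv0 => /eqP.
apply: (@comm_iter_diagonalizable _ _ s y (N + (n + n)) sd).
have -> : iter (N + (n + n)) (comm s) y =
    iter (N + (n + n)) (fun z => comm x z - comm (x - s) z) y.
  by apply: eq_iter => z; apply/esym/eqP; rewrite subr_eq -commDl addrC subrK.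
apply: (@iter_sub_nil _ (comm x) (comm (x - s))) => //; last exact: comm_nilp.
have xsC : comm x (x - s) = 0.
  rewrite linearB /= comm_self sub0r; apply/eqP; rewrite oppr_eq0 subr_eq0; apply/eqP.
  exact/comm_mx_horner/comm_mx_refl.
by move=> z /=; rewrite comm_jacobi xsC /comm mul0mx mulmx0 subr0 add0r.
Qed.

(** The semisimple part s of an x in H acts by zero on the centralizer Z of [As], so [ad x] acts on
    Z as the nilpotent [ad (x - s)]. If Z were not inside H, [normalizer_grows] would give an
    element outside H that normalizes H. *)
Lemma cartan_torus : exists As : seq M, {in As, forall a, torus_elt a} /\
  forall x, x \in L -> {in As, forall a, comm a x = 0} -> x \in H.
Proof.
have [As [AsT AsS]] := span_exhaust torus_elt; exists As; split=> // x0 x0L x0As.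
pose Z := (L :&: \bigcap_(a <- As) lker (linfun (comm a)))%VS.
have ZP x : x \in Z <-> x \in L /\ {in As, forall a, comm a x = 0}.
  rewrite /Z big_tnth memv_cap; split=> [/andP[-> /subv_bigcapP xA]|[-> xA]].
    split=> // a aA; have /tnthP[i ->] : a \in in_tuple As := aA.
    by have := xA i isT; rewrite -memvE memv_ker lfunE => /eqP.
  by apply/subv_bigcapP => i _; rewrite -memvE memv_ker lfunE /= xA // mem_tnth.
have stZ : stable H Z.
  move=> x z xH /ZP[zL zA]; apply/ZP; split=> [|a aA].
    by apply: (jsym_subalg JJ) => //; apply: (subvP HL).
  have [_ _ aH] := AsT a aA.
  by rewrite comm_jacobi (aH x xH) (zA a aA) /comm mul0mx !mulmx0 mul0mx !subrr addr0.
suff /subvP : (Z <= H)%VS by apply; apply/ZP.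
apply: contrapT => /negP ZH.
have [z [zZ /negP zH zN]] : exists z, [/\ z \in Z, z \notin H & {in H, forall x, comm x z \in H}].
  apply: normalizer_grows => //.
  move=> x z xH /ZP[zL zA]; have [s [sT xsn]] := cartan_jordan xH.
  exists (n + n); suff -> : iter (n + n) (comm x) z = iter (n + n) (comm (x - s)) z.
    by rewrite comm_nilp ?mem0v.
  have sz w : w \in Z -> comm s w = 0.
    move=> /ZP[_ wA]; apply/eqP; rewrite -memv0.
    by apply: comm_span (AsS _ sT) => c cA; rewrite wA ?mem0v.
  suff it k : iter k (comm x) z \in Z /\ iter k (comm x) z = iter k (comm (x - s)) z.
    by have [] := it (n + n).
  elim: k => [|k [IZ IE]] /=; first by split=> //; apply/ZP.
  by split; [exact: stZ | rewrite -IE -{1}[x](subrK s) commDl sz // addr0].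
by apply: zH; apply: Hnorm => //; case/ZP: zZ.
Qed.

Lemma jsym_conj_diag (P : M) (d : 'rV[K]_n) : P \in unitmx ->
  reflect (forall i j, (d 0 i + d 0 j) * (P^T *m J *m P) i j = 0)
          (P *m diag_mx d *m invmx P \in L).
Proof.
move=> Pu; pose X := P *m diag_mx d *m invmx P; pose G := P^T *m J *m P.
have XP : X *m P = P *m diag_mx d by rewrite /X mulmxKV.
have EX : (X \in L) = (J *m X + X^T *m J == 0).
  rewrite (sameP (jsymP _ _ _) eqP) scale1r /jadj.
  apply/eqP/eqP => [E|/eqP].
    by rewrite -{1}E !mulmxA JJ mulNmx mul1mx mulNmx addNr.
  rewrite addr_eq0 => /eqP/(congr1 (mulmx J)).
  by rewrite !mulmxN mulmxA JJ mulNmx mul1mx !mulmxA => /oppr_inj.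
rewrite -/X; clearbody X.
have EG : P^T *m (J *m X + X^T *m J) *m P = G *m diag_mx d + diag_mx d *m G.
  rewrite mulmxDr mulmxDl; congr (_ + _); rewrite /G -!mulmxA ?XP //.
  by rewrite mulmxA -trmx_mul XP trmx_mul tr_diag_mx -!mulmxA.
rewrite EX; apply: (iffP eqP) => [E i j|E].
  have := congr1 (fun A : M => A i j) EG; rewrite E mulmx0 mul0mx anticomm_diag => <-.
  by rewrite mxE.
have : P^T *m (J *m X + X^T *m J) *m P = 0.
  by rewrite EG; apply/matrixP=> i j; rewrite anticomm_diag E mxE.
move=> /(congr1 (fun A => invmx P^T *m A *m invmx P)).
by rewrite mulmx0 mul0mx !mulmxA mulVmx ?unitmx_tr // mul1mx mulmxK.
Qed.

(* If the weight of column i of P vanished, or coincided with that of another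
   column, brackets of the elements [sdyad (p i) (p j)] of H would produce an
   eigenvector in H with nonzero eigenvalue, against [no_eigen]. *)
Lemma cartan_jsym : exists (P : M) (t : 'I_n -> 'I_n),
  [/\ P \in unitmx, involutive t /\ (forall i, t i != i),
      forall i j, ((P^T *m J *m P) i j != 0) = (j == t i)
    & forall X, X \in H <-> exists d : 'rV_n,
        (forall i, d 0 (t i) = - d 0 i) /\ X = P *m diag_mx d *m invmx P].
Proof.
have [As [AsT AsH]] := cartan_torus.
have [P0 P0u /allP AsD] : codiagonalizable As.
  apply/codiagonalizableP; split=> [a b aA bA|a aA]; last by have [] := AsT a aA.
  have [_ _ /(_ b (torus_elt_mem (AsT b bA)))/eqP] := AsT a aA.
  by rewrite /comm subr_eq0 => /eqP.
pose P := invmx P0; have Pu : P \in unitmx by rewrite unitmx_inv.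
have {AsD} AsD a : a \in As -> exists d : 'rV_n, a = P *m diag_mx d *m invmx P.
  by move=> /AsD /(diagonalizable_forLR P0u)[d ->]; exists d; rewrite mxpoly.conjumx.
pose G := P^T *m J *m P; pose p i := col i P.
have Gform i j : jformJ (p i) (p j) = G i j.
  by rewrite /G /jform /p tr_col -!row_mul colE mulmxA -colE [LHS]mxE [LHS]mxE.
pose lam i a := (invmx P *m a *m P) i i.
have lamP a i : a \in As -> a *m p i = lam i a *: p i.
  case/AsD=> d ->; rewrite /lam !mulmxA mulVmx // mul1mx mulmxKV // mxE eqxx mulr1n.
  rewrite /p !colE mulmxA mulmxKV // -mulmxA -[diag_mx d *m _]colE.
  rewrite scalemxAr; congr (P *m _).
  apply/matrixP=> k l; rewrite !mxE (ord1 l) eqxx andbT.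
  by case: eqVneq => [->|_]; rewrite ?mulr1n ?mulr0n ?mulr1 ?mulr0.
pose opp i j := {in As, forall a, lam i a + lam j a = 0}.
have zH i j : opp i j -> sdyadJ (p i) (p j) \in H.
  move=> ij; apply: AsH; first exact: sdyad_jsym.
  move=> a aA; have [aL _ _] := AsT a aA.
  by rewrite (comm_sdyad JT JJ) // !lamP // sdyadZl sdyadZr -scalerDl ij // scale0r.
have Gopp i j : G i j != 0 -> opp i j.
  move=> Gij a aA; have [/jsymP aL _ _] := AsT a aA; rewrite scale1r in aL.
  have := jform_mul JT JJ a (p i) (p j); rewrite aL !lamP // jformZr (jformZl JT) Gform.
  by move=> /eqP; rewrite -subr_eq0 opprK -mulrDl mulf_eq0 (negPf Gij) orbF addrC => /eqP.
have GC i j : G j i = - G i j by rewrite -!Gform (jformC JT).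
have Gii i : G i i = 0 by rewrite -Gform (jform_self JT).
have p0 i : p i != 0.
  apply/eqP => /(congr1 (mulmx (invmx P))); rewrite /p colE mulKmx // mulmx0.
  by move=> /matrixP/(_ i 0)/eqP; rewrite !mxE !eqxx oner_eq0.
have Gex i : exists j, G i j != 0.
  have [v] := jform_nondeg JT JJ (p0 i); rewrite (jformC JT) oppr_eq0 => iv.
  apply/existsP; apply: contraNT iv; rewrite negb_exists => /forallP iv.
  have -> : v = \sum_j (invmx P *m v) j 0 *: p j.
    rewrite -[v in LHS](mulKVmx Pu) {1}[invmx P *m v]matrix_sum_delta.
    rewrite mulmx_sumr; apply: eq_bigr => j _.
    by rewrite big_ord1 -scalemxAr /p colE.
  rewrite linear_sum big1 // => j _; rewrite linearZ /= Gform.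
  by have := iv j; rewrite negbK => /eqP->; rewrite scaler0.
have sd0 u v : sdyadJ u v = 0 -> u != 0 -> v != 0 -> False.
  by case/sdyad_eq0 => ->; rewrite eqxx.
have zapp i j k : sdyadJ (p i) (p j) *m p k = G j k *: p i + G i k *: p j.
  by rewrite sdyad_app !Gform.
have Nopp i : ~ opp i i.
  move=> ii; have [j Gij] := Gex i.
  (* [sdyad (p i) (p j)] scales [p i] by [G j i], hence its bracket scales [sdyad (p i) (p i)] by
     twice that. *)
  apply: (sd0 (p i) (p i)) => //; apply: (@no_eigen _ _ H (G j i *+ 2) _ _ Hnil (zH i j (Gopp _ _ Gij)) (zH i i ii)).
    rewrite (comm_sdyad JT JJ) ?sdyad_jsym // zapp Gii scale0r addr0.
    by rewrite sdyadZl sdyadZr -scalerDl -mulr2n.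
  by rewrite mulrn_eq0 /= GC oppr_eq0.
have lam_inj i k : {in As, forall a, lam i a = lam k a} -> i = k.
  move=> ik; apply/eqP; apply: contrapT => /negP nik.
  have [j Gij] := Gex i; have oij := Gopp _ _ Gij.
  have okj : opp k j by move=> a aA; rewrite -ik ?oij.
  have Gik : G i k = 0.
    apply/eqP; apply: contrapT => /negP/Gopp oik.
    by apply: (Nopp i) => a aA; rewrite {2}ik ?oik.
  (* The matrix [sdyad (p i) (p j)] sends [p k] to [G j k *: p i] and [p j] to [G i j *: p j]. The
     coefficients of [p i] and [p k] are chosen so that y becomes an eigenvector, of eigenvalue
     [G i j]. *)
  pose y := sdyadJ (G j k *: p i + G i j *: p k) (p j).
  have Ey : y = G j k *: sdyadJ (p i) (p j) + G i j *: sdyadJ (p k) (p j).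
    by rewrite /y sdyadDl !sdyadZl.
  have yH : y \in H by rewrite Ey memvD // memvZ // zH.
  have : y = 0.
    apply: (@no_eigen _ _ H (G i j) _ _ Hnil (zH i j oij) yH) => //.
    rewrite {1}Ey linearD !linearZ /= comm_self scaler0 add0r; congr (_ *: _).
    rewrite (comm_sdyad JT JJ) ?sdyad_jsym // !zapp Gik Gii !scale0r addr0 add0r.
    by rewrite sdyadZl sdyadZr -Ey.
  move/sd0; apply => //; apply: contraNneq Gij.
  move/(congr1 (mulmx (invmx P))); rewrite mulmx0 mulmxDr -!scalemxAr /p !colE !mulKmx //.
  move=> /matrixP/(_ k 0); rewrite !mxE !eqxx eq_sym (negPf nik) mulr0 add0r mulr1.
  by move=> ->.
have Gopp_uniq i j k : opp i j -> opp i k -> j = k.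
  move=> oj ok; apply: lam_inj => a aA.
  by apply: (addrI (lam i a)); rewrite oj ?ok.
have [t tP] : exists t : 'I_n -> 'I_n, forall i, G i (t i) != 0.
  by exists (fun i => xchoose (Gex i)) => i; exact: xchooseP (Gex i).
have Gt i j : (G i j != 0) = (j == t i).
  apply/idP/eqP => [Gij|->]; last exact: tP.
  exact: Gopp_uniq (Gopp _ _ Gij) (Gopp _ _ (tP i)).
exists P, t; split=> //.
  split=> i.
    by apply/esym/eqP; rewrite -Gt GC oppr_eq0.
  by apply/eqP => ti; have := tP i; rewrite ti Gii eqxx.
have opp_sum (d : 'rV_n) : (forall i, d 0 (t i) = - d 0 i) ->
    forall i j, (d 0 i + d 0 j) * G i j = 0.
  move=> dt i j; have [->|] := eqVneq (G i j) 0; first by rewrite mulr0.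
  by rewrite Gt => /eqP->; rewrite dt subrr mul0r.
move=> X; split=> [XH|[d [dt ->]]]; last first.
  apply: AsH; first by apply/jsym_conj_diag/opp_sum.
  move=> a /AsD[e ->]; rewrite conj_comm // (_ : comm _ _ = 0) ?mulmx0 ?mul0mx //.
  by apply/eqP; rewrite subr_eq0 diag_mxC.
pose Y := invmx P *m X *m P; have EX : X = P *m Y *m invmx P.
  by rewrite /Y !mulmxA mulmxV // mul1mx mulmxK.
pose d : 'rV_n := \row_i Y i i.
(* X commutes with the torus, and distinct columns have distinct weights, so X is diagonal in the
   basis P. *)
have EY : Y = diag_mx d.
  apply/matrixP=> i j; rewrite [RHS]mxE; have [->|ij] := eqVneq i j; first by rewrite mulr1n [RHS]mxE.
  rewrite mulr0n.
  have /existsNP[a /not_implyP[aA /eqP lij]] : ~ {in As, forall a, lam i a = lam j a}.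
    by move/lam_inj/eqP; rewrite (negPf ij).
  have [_ _ aH] := AsT a aA; have := aH X XH.
  have [e Ea] := AsD a aA; have lamE k : lam k a = e 0 k.
    by rewrite /lam Ea !mulmxA mulVmx // mul1mx mulmxKV // mxE eqxx mulr1n.
  rewrite Ea EX conj_comm // => /(congr1 (fun A => invmx P *m A *m P)).
  rewrite mulmx0 mul0mx !mulmxA mulVmx // mul1mx mulmxKV // => /matrixP/(_ i j).
  rewrite comm_diag [RHS]mxE => /eqP; rewrite mulf_eq0 subr_eq0 -!lamE (negPf lij) /=.
  by move=> /eqP.
exists d; split=> [i|]; last by rewrite EX EY.
have XL := subvP HL _ XH; rewrite EX EY in XL.
have /(_ i (t i))/eqP := elimT (jsym_conj_diag d Pu) XL.
by rewrite mulf_eq0 (negPf (tP i)) orbF addrC addr_eq0 => /eqP.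
Qed.

End Subalgebra.
End Cartan.


(** * The grading of sp(4l) *)

Section Transport.
Variables (K : fieldType) (m1 m2 : nat) (f : 'Hom('M[K]_m1, 'M[K]_m2)).
Hypotheses (f_inj : lker f = 0%VS)
  (fM : forall x y, f (comm x y) = comm (f x) (f y)).
Implicit Types (L U : {vspace 'M[K]_m1}).

Let finj : injective f. Proof. by apply/lker0P; rewrite f_inj. Qed.

Lemma preim_limg U : (f @^-1: (f @: U))%VS = U.
Proof.
apply/vspaceP => x; rewrite -memv_preim; apply/idP/idP; last exact: memv_img.
by case/memv_imgP=> y yU /finj->.
Qed.

Lemma limg_preim_sub L (U : {vspace 'M[K]_m2}) :
  (U <= f @: L)%VS -> (f @: (f @^-1: U))%VS = U.
Proof. by move=> UL; apply: lpreimK; apply: subv_trans UL (limgS _ (subvf _)). Qed.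

Lemma preim_sub L (U : {vspace 'M[K]_m2}) :
  (U <= f @: L)%VS -> (f @^-1: U <= L)%VS.
Proof.
move=> /subvP UL; apply/subvP=> x; rewrite -memv_preim => /UL.
by case/memv_imgP=> y yU /finj->.
Qed.

Lemma limg_stable L U : stable L U -> stable (f @: L) (f @: U).
Proof.
by move=> st _ _ /memv_imgP[x xL ->] /memv_imgP[y yU ->]; rewrite -fM memv_img ?st.
Qed.

Lemma preim_stable L (U : {vspace 'M[K]_m2}) :
  stable (f @: L) U -> stable L (f @^-1: U).
Proof.
by move=> st x y xL; rewrite -!memv_preim fM => /(st _ _ (memv_img f xL)).
Qed.

Lemma limg_irr L U : mod_irr L U -> mod_irr (f @: L) (f @: U).
Proof.
case=> U0 st irr; split=> [E||W sW stW]; last 1 first.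
- have [E|E] := irr _ (preim_sub sW) (preim_stable stW).
    by left; rewrite -(limg_preim_sub sW) E limg0.
  by right; rewrite -(limg_preim_sub sW) E.
- by apply: U0; rewrite -[U]preim_limg E -f_inj -lpreim0.
- exact: limg_stable.
Qed.

Lemma limg_simple L : simple_lie L -> simple_lie (f @: L).
Proof.
case=> sub [x [y [xL yL xy]]] simp; split.
- by move=> _ _ /memv_imgP[u uL ->] /memv_imgP[v vL ->]; rewrite -fM memv_img ?sub.
- exists (f x), (f y); split; rewrite ?memv_img // -fM.
  by apply: contra_neq xy => E; apply: finj; rewrite E linear0.
move=> W sW stW; have [E|E] := simp _ (preim_sub sW) (preim_stable stW).
  by left; rewrite -(limg_preim_sub sW) E limg0.
by right; rewrite -(limg_preim_sub sW) E.
Qed.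

Lemma lie_prod_limg U U' :
  lie_prod (f @: U) (f @: U') = (f @: lie_prod U U')%VS.
Proof.
apply/eqP; rewrite eqEsubv; apply/andP; split.
  apply/span_subvP=> _ /allpairsP[[u v] /= [uU vU ->]].
  have /memv_imgP[x xU ->] := vbasis_mem uU; have /memv_imgP[y yU ->] := vbasis_mem vU.
  by rewrite -fM memv_img // mem_lie_prod.
apply/subvP=> _ /memv_imgP[z zU ->]; rewrite memv_preim; apply: (subvP _ _ zU).
apply/span_subvP=> _ /allpairsP[[u v] [/= /vbasis_mem uU /vbasis_mem vU ->]].
by rewrite -memv_preim fM mem_lie_prod ?memv_img.
Qed.

Lemma preim_cartan L (H : {vspace 'M[K]_m2}) :
  cartan_subalg (f @: L) H -> cartan_subalg L (f @^-1: H).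
Proof.
case=> sH Hsub [k Hk] Hn; split.
- exact: preim_sub.
- by move=> x y; rewrite -!memv_preim fM; apply: Hsub.
- exists k; set U := (f @^-1: H)%VS.
  have it j : (f @: iter j (lie_prod U) U)%VS = iter j (lie_prod H) H.
    elim: j => /= [|j IHj]; first exact: limg_preim_sub sH.
    by rewrite -lie_prod_limg IHj (limg_preim_sub sH).
  by rewrite -[LHS]preim_limg it Hk lpreim0 f_inj.
move=> x xL xn; rewrite -memv_preim; apply: Hn; first exact: memv_img.
move=> y' y'H; have /memv_imgP[y yL Ey] := subvP sH _ y'H.
by rewrite Ey -fM memv_preim xn // -memv_preim -Ey.
Qed.

End Transport.

(** * The standard form and the antidiagonal form *)

Section Standard.
Variables (K : numFieldType) (m : nat).

Definition Jstd : 'M[K]_(m + m) := block_mx 0 1%:M (- 1%:M) 0.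

Lemma Jstd_tr : Jstd^T = - Jstd.
Proof. by rewrite /Jstd tr_block_mx opp_block_mx !linear0 linearN /= !trmx1 opprK. Qed.

Lemma Jstd_sq : Jstd *m Jstd = - 1%:M.
Proof.
rewrite /Jstd mulmx_block !mul0mx !mulmx0 !mulmx1 !mul1mx !addr0 !add0r.
by rewrite scalar_mx_block opp_block_mx !oppr0.
Qed.

Lemma jadj_Jstd (a b c d : 'M[K]_m) :
  jadj Jstd (block_mx a b c d) = block_mx (- d^T) b^T c^T (- a^T).
Proof.
rewrite /jadj /Jstd tr_block_mx !mulmx_block.
by rewrite !(mul0mx, mulmx0, mulmxN, mulNmx, opprK, mulmx1, mul1mx, addr0, add0r).
Qed.

Lemma sp_jsym : sp K m = jsym Jstd 1.
Proof.
apply/vspaceP => X; apply/idP/jsymP; rewrite scale1r.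
  case/mem_sp=> a [b [c [Eb Ec ->]]].
  by rewrite jadj_Jstd Eb Ec linearN /= trmxK opprK.
rewrite -{1 2}[X]submxK jadj_Jstd => /eq_block_mx[_ Eb Ec Ed].
apply/mem_sp; exists (ulsubmx X), (ursubmx X), (dlsubmx X); split=> //.
by rewrite Ed submxK.
Qed.

Lemma sp_simple : (0 < m)%N -> simple_lie (sp K m).
Proof.
by move=> m0; rewrite sp_jsym; apply: (jsym_simple Jstd_tr Jstd_sq); rewrite addn_gt0 m0.
Qed.

Lemma killing_sp x y : x \in sp K m -> y \in sp K m ->
  killing (sp K m) x y = (m + m).+2%:R * \tr (x *m y).
Proof. by rewrite sp_jsym; apply: (killing_jsym Jstd_tr Jstd_sq). Qed.

End Standard.

Section Antidiagonal.
Variable K : numFieldType.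

Definition antidiag m : 'M[K]_m :=
  \matrix_(i, j) ((-1) ^+ i.+1 *+ (j == rev_ord i)).

Lemma sign_rev m (i : 'I_m) : ~~ odd m -> (-1) ^+ (rev_ord i).+1 = - (-1) ^+ i.+1 :> K.
Proof.
move=> em; have : odd (rev_ord i).+1 = ~~ odd i.+1.
  have : (i.+1 + rev_ord i)%N = m by rewrite /= subnKC.
  move: (nat_of_ord (rev_ord i)) => r /(congr1 odd); rewrite oddD (negPf em) /=.
  by case: (odd i); case: (odd r).
rewrite -signr_odd => ->; rewrite -[in RHS]signr_odd.
by case: (odd _); rewrite ?expr0 ?expr1 ?opprK.
Qed.

Lemma antidiag_tr m : ~~ odd m -> (antidiag m)^T = - antidiag m.
Proof.
move=> em; apply/matrixP=> i j; rewrite !mxE eq_sym (can2_eq (@rev_ordK m) (@rev_ordK m)).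
by have [->|] := eqVneq j (rev_ord i); rewrite ?mulr0n ?oppr0 // sign_rev.
Qed.

Lemma antidiag_sq m : ~~ odd m -> antidiag m *m antidiag m = - 1%:M.
Proof.
move=> em; apply/matrixP=> i j; rewrite !mxE (bigD1 (rev_ord i)) //= big1 => [|k ki].
  rewrite !mxE eqxx addr0 rev_ordK mulr1n sign_rev // eq_sym.
  case: eqVneq => [_|_]; last by rewrite !mulr0n mulr0 oppr0.
  by rewrite !mulr1n mulrN -expr2 sqrr_sign.
by rewrite mxE (negPf ki) mulr0n mul0r.
Qed.

Lemma rev_lshift m (i : 'I_m) : rev_ord (lshift m i) = rshift m (rev_ord i).
Proof. by apply: val_inj => /=; rewrite addnBA. Qed.

Lemma rev_rshift m (i : 'I_m) : rev_ord (rshift m i) = lshift m (rev_ord i).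
Proof. by apply: val_inj => /=; rewrite -addnS subnDl. Qed.

(* The diagonal blocks of [antidiag m] vanish, so that Q = diag(B, 1) works, B
   being its upper right block. *)
Lemma antidiag_congr m l : m = (l + l)%N -> exists Q : 'M[K]_(m, l + l),
  [/\ Q *m Q^T = 1%:M, Q^T *m Q = 1%:M & Q *m Jstd K l *m Q^T = antidiag m].
Proof.
move=> E; subst m; have em : ~~ odd (l + l) by rewrite addnn odd_double.
have := antidiag_tr em; have := antidiag_sq em.
have Eul : ulsubmx (antidiag (l + l)) = 0.
  by apply/matrixP=> i j; rewrite !mxE rev_lshift eq_lrshift mulr0n.
have Edr : drsubmx (antidiag (l + l)) = 0.
  by apply/matrixP=> i j; rewrite !mxE rev_rshift eq_rlshift mulr0n.
move: (antidiag _) Eul Edr => A; rewrite -[A]submxK block_mxKul block_mxKdr => -> ->.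
move: (ursubmx A) (dlsubmx A) => B C.
rewrite tr_block_mx opp_block_mx mulmx_block scalar_mx_block opp_block_mx.
rewrite !(mul0mx, mulmx0, addr0, add0r, trmx0, oppr0).
move=> /eq_block_mx[BC _ _ CB] /eq_block_mx[_ EB _ _].
have {}EB : C = - B^T by apply: trmx_inj; rewrite linearN /= trmxK EB.
rewrite {C}EB in BC CB *.
have BB : B *m B^T = 1%:M by apply: oppr_inj; rewrite -mulmxN.
have BB' : B^T *m B = 1%:M by apply: oppr_inj; rewrite -mulNmx.
exists (block_mx B 0 0 1%:M); rewrite tr_block_mx !trmx0 trmx1 /Jstd !mulmx_block.
by split; rewrite !(mul0mx, mulmx0, mulmx1, mul1mx, mulmxN, mulNmx, addr0, add0r, oppr0) ?BB ?BB'.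
Qed.

End Antidiagonal.

Section Blocks.
Variable K : numFieldType.

Lemma delta_sum m (c : 'I_m -> K) (f : 'I_m -> 'I_m) i j :
  (\sum_k c k *: delta_mx k (f k)) i j = c i *+ (j == f i).
Proof.
rewrite summxE (bigD1 i) //= big1 => [|k ki]; last by rewrite !mxE eq_sym (negPf ki) mulr0.
by rewrite !mxE eqxx addr0 /=; case: (_ == _); rewrite ?mulr1 ?mulr0.
Qed.

Lemma A0_block l : A0 K l = block_mx 0 (antidiag K (2 * l)) (antidiag K (2 * l)) 0.
Proof.
apply/matrixP=> i j; rewrite /A0 delta_sum.
case: (split_ordP i) => i' ->; case: (split_ordP j) => j' ->.
- by rewrite block_mxEul mxE rev_lshift eq_lrshift mulr0n.
- by rewrite block_mxEur mxE rev_lshift eq_rshift.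
(* The row index is shifted by the even number 2l, which leaves the sign unchanged. *)
- rewrite block_mxEdl mxE rev_rshift eq_lshift /= -addnS exprD.
  by rewrite -signr_odd oddM /= expr0 mul1r.
- by rewrite block_mxEdr mxE rev_rshift eq_rlshift mulr0n.
Qed.

Lemma A1_block l : A1 K l = block_mx 0 (antidiag K (2 * l)) (- antidiag K (2 * l)) 0.
Proof.
apply/matrixP=> i j; rewrite /A1 sumrB [LHS]mxE oppmxE !summxE.
case: (split_ordP i) => i' ->; case: (split_ordP j) => j' ->.
- rewrite block_mxEul mxE !big1 ?subrr // => k _; rewrite !mxE ?rev_lshift ?eq_lrshift ?andbF ?mulr0 //.
- rewrite block_mxEur mxE [X in _ - X]big1 => [|k _]; last by rewrite !mxE eq_lrshift mulr0.
  rewrite subr0 (bigD1 i') //= big1 => [|k ki]; rewrite !mxE ?rev_lshift.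
    by rewrite eqxx eq_rshift addr0; case: (_ == _); rewrite ?mulr1 ?mulr0.
  by rewrite eq_lshift eq_sym (negPf ki) mulr0.
- rewrite block_mxEdl !mxE big1 => [|k _]; last by rewrite !mxE eq_rlshift mulr0.
  rewrite sub0r (bigD1 i') //= big1 => [|k ki]; rewrite !mxE.
    by rewrite eqxx eq_lshift addr0; case: (_ == _); rewrite ?mulr1 ?mulr0.
  by rewrite eq_rshift eq_sym (negPf ki) mulr0.
- rewrite block_mxEdr mxE !big1 ?subrr // => k _; rewrite !mxE ?eq_rlshift ?andbF ?mulr0 //.
Qed.

Lemma invmx_eq m (A B : 'M[K]_m) : A *m B = 1%:M -> invmx A = B.
Proof.
move=> AB; have [Au _] := mulmx1_unit AB.
by rewrite -[RHS](mulKmx Au) AB mulmx1.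
Qed.

Variables (m : nat) (T : 'M[K]_m).
Hypotheses (TT : T^T = - T) (T2 : T *m T = - 1%:M).
Let B0 : 'M[K]_(m + m) := block_mx 0 T T 0.
Let B1 : 'M[K]_(m + m) := block_mx 0 T (- T) 0.
Local Notation blockE := (mul0mx, mulmx0, mulmxN, mulNmx, opprK, addr0, add0r, oppr0).

(** [B0^2 = -1], whereas the sign in [B1] makes [B1^2 = 1]. Either square is scalar, so both [Ad]
    are involutions. *)
Lemma B0_inv : invmx B0 = - B0.
Proof.
apply: invmx_eq; rewrite /B0 mulmxN mulmx_block !blockE T2 opp_block_mx.
by rewrite scalar_mx_block !blockE.
Qed.

Lemma B1_inv : invmx B1 = B1.
Proof.
by apply: invmx_eq; rewrite /B1 mulmx_block !blockE T2 scalar_mx_block !blockE.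
Qed.

Lemma AdE (A X : 'M[K]_(m + m)) : Ad A X = A *m X *m invmx A.
Proof. exact: (lfunE (mulmxr (invmx A) \o mulmx A) X). Qed.

Lemma Ad_B0 (a b c d : 'M[K]_m) : Ad B0 (block_mx a b c d) =
  block_mx (- (T *m d *m T)) (- (T *m c *m T)) (- (T *m b *m T)) (- (T *m a *m T)).
Proof.
by rewrite AdE B0_inv /B0 mulmxN !mulmx_block !blockE opp_block_mx.
Qed.

Lemma Ad_B1 (a b c d : 'M[K]_m) : Ad B1 (block_mx a b c d) =
  block_mx (- (T *m d *m T)) (T *m c *m T) (T *m b *m T) (- (T *m a *m T)).
Proof. by rewrite AdE B1_inv /B1 !mulmx_block !blockE. Qed.


Definition phi_fun (a : 'M[K]_m) : 'M[K]_(m + m) := block_mx a 0 0 (- a^T).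
Lemma phi_is_linear : linear phi_fun.
Proof.
move=> c u v; rewrite /phi_fun scale_block_mx add_block_mx !scaler0 !addr0.
by rewrite linearP /= opprD scalerN.
Qed.
HB.instance Definition _ := GRing.isLinear.Build K _ _ _ phi_fun phi_is_linear.
Definition phi : 'Hom('M[K]_m, 'M[K]_(m + m)) := linfun phi_fun.

Lemma phiE a : phi a = block_mx a 0 0 (- a^T).
Proof. by rewrite lfunE. Qed.

Lemma phi_inj : lker phi = 0%VS.
Proof.
by apply/eqP/lker0P => a b; rewrite !phiE => /eq_block_mx[].
Qed.

Lemma phiM a b : phi (comm a b) = comm (phi a) (phi b).
Proof.
rewrite !phiE /comm !mulmx_block !blockE opp_block_mx add_block_mx !blockE.
by rewrite linearB /= !trmx_mul opprB.
Qed.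

(** The factor T turns elements of [S+] into symmetric matrices. The sign e is the eigenvalue of the
    first automorphism: 1 for g_01 and -1 for g_10. *)
Definition psi_fun e (s : 'M[K]_m) : 'M[K]_(m + m) :=
  block_mx 0 (s *m T) (e *: (T *m s)) 0.
Lemma psi_is_linear e : linear (psi_fun e).
Proof.
move=> c u v; rewrite /psi_fun scale_block_mx add_block_mx !scaler0 !addr0.
by rewrite mulmxDl mulmxDr scalemxAl -scalemxAr scalerDr !scalerA [c * e]mulrC.
Qed.
HB.instance Definition _ e := GRing.isLinear.Build K _ _ _ (psi_fun e) (psi_is_linear e).
Definition psi e : 'Hom('M[K]_m, 'M[K]_(m + m)) := linfun (psi_fun e).

Lemma psiE e s : psi e s = block_mx 0 (s *m T) (e *: (T *m s)) 0.
Proof. by rewrite lfunE. Qed.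

Lemma psi_inj e : lker (psi e) = 0%VS.
Proof.
apply/eqP/lker0P => a b; rewrite !psiE => /eq_block_mx[_ /(congr1 (mulmx^~ T)) E _ _].
by move: E; rewrite -!mulmxA T2 !mulmxN !mulmx1 => /oppr_inj.
Qed.

Lemma jsym_mulTr a : a \in jsym T 1 -> T *m a^T = - (a *m T).
Proof.
move=> /jsymP; rewrite scale1r /jadj => E.
by rewrite -[in RHS]E -[_ *m T *m T]mulmxA T2 mulmxN mulmx1 opprK.
Qed.

Lemma jsym_mulTl a : a \in jsym T 1 -> a^T *m T = - (T *m a).
Proof.
move=> /jsymP; rewrite scale1r /jadj => E.
by rewrite -[in RHS]E !mulmxA T2 mulNmx mul1mx mulNmx opprK.
Qed.

Lemma psiM e a b : a \in jsym T 1 -> psi e (comm a b) = comm (phi a) (psi e b).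
Proof.
move=> aS; rewrite phiE !psiE /comm !mulmx_block !blockE opp_block_mx add_block_mx !blockE.
rewrite -[b *m T *m a^T]mulmxA (jsym_mulTr aS) -scalemxAr [a^T *m _]mulmxA (jsym_mulTl aS).
congr block_mx; first by rewrite mulmxBl mulmxN !mulmxA.
by rewrite mulmxBr scalerBr mulNmx scalerN opprK -scalemxAl !mulmxA.
Qed.

Lemma sp_block (a b c d : 'M[K]_m) :
  block_mx a b c d \in sp K m <-> [/\ b^T = b, c^T = c & d = - a^T].
Proof.
split=> [/mem_sp[a' [b' [c' [Eb Ec /eq_block_mx[-> -> -> ->]]]]] //|[Eb Ec ->]].
by apply/mem_sp; exists a, b, c.
Qed.

Lemma eq_oppr0 (V : lmodType K) (x : V) : x = - x -> x = 0.
Proof.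
move/eqP; rewrite -subr_eq0 opprK -mulr2n -scaler_nat scaler_eq0 pnatr_eq0 /=.
by move/eqP.
Qed.

(** The two automorphisms differ by a sign on the off-diagonal blocks, which must therefore vanish.
    On the diagonal they agree, and the equation says [jadj a = e a]. *)
Lemma eigen_diag e X : e * e = 1 ->
  [/\ X \in sp K m, Ad B0 X = e *: X & Ad B1 X = e *: X] <->
  X \in (phi @: jsym T e)%VS.
Proof.
move=> ee; have inj (V : lmodType K) (u v : V) : e *: u = e *: v -> u = v.
  by move/(congr1 (GRing.scale e)); rewrite !scalerA ee !scale1r.
split=> [[]|/memv_imgP[a /jsymP aS ->]].
  rewrite -[X]submxK; move: (ulsubmx X) (ursubmx X) (dlsubmx X) (drsubmx X) => a b c d.
  move=> /sp_block[Eb Ec ->]; rewrite Ad_B0 Ad_B1 !scale_block_mx.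
  move=> /eq_block_mx[Ea Eb1 Ec1 _] /eq_block_mx[_ Eb2 Ec2 _].
  have -> : b = 0 by apply: inj; rewrite scaler0; apply: eq_oppr0; rewrite -{1}Eb1 -Eb2.
  have -> : c = 0 by apply: inj; rewrite scaler0; apply: eq_oppr0; rewrite -{1}Ec1 -Ec2.
  rewrite -phiE memv_img //; apply/jsymP; rewrite /jadj -Ea.
  by rewrite mulmxN mulNmx opprK.
have aT : T *m a *m T = e *: a^T.
  have := congr1 trmx aS; rewrite linearZ /= => <-.
  by rewrite /jadj !trmx_mul trmxK TT mulNmx !mulmxN opprK mulmxA.
rewrite phiE; split; first by apply/sp_block; rewrite !trmx0.
  rewrite Ad_B0 scale_block_mx !mulmx0 !mul0mx oppr0 scaler0 mulmxN mulNmx opprK.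
  by rewrite aT -[T *m a^T *m T]/(jadj T a) aS scalerN.
rewrite Ad_B1 scale_block_mx !mulmx0 !mul0mx scaler0 mulmxN mulNmx opprK.
by rewrite aT -[T *m a^T *m T]/(jadj T a) aS scalerN.
Qed.

(** With opposite eigenvalues it is the diagonal blocks that vanish. The lower block is determined
    by the upper block b, and b = s T for [s = - b T], which lies in [S+] because b is symmetric. *)
Lemma eigen_anti e X : e * e = 1 ->
  [/\ X \in sp K m, Ad B0 X = e *: X & Ad B1 X = - e *: X] <->
  X \in (psi e @: jsym T 1)%VS.
Proof.
move=> ee; have inj (V : lmodType K) (u v : V) : e *: u = e *: v -> u = v.
  by move/(congr1 (GRing.scale e)); rewrite !scalerA ee !scale1r.
split=> [[]|/memv_imgP[s sS ->]].
  rewrite -[X]submxK; move: (ulsubmx X) (ursubmx X) (dlsubmx X) (drsubmx X) => a b c d.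
  move=> /sp_block[Eb Ec ->]; rewrite Ad_B0 Ad_B1 !scale_block_mx.
  move=> /eq_block_mx[Ea Eb1 Ec1 _] /eq_block_mx[Ea2 Eb2 Ec2 _].
  have -> : a = 0 by apply: inj; rewrite scaler0; apply: eq_oppr0; rewrite -{1}Ea -scaleNr -Ea2.
  have -> : c = - e *: (T *m b *m T).
    by apply: inj; rewrite -Ec1 scaleNr scalerN scalerA ee scale1r.
  apply/memv_imgP; exists (- (b *m T)).
    apply/jsymP; rewrite scale1r /jadj linearN /= trmx_mul Eb TT.
    by rewrite !mulNmx opprK mulmxA T2 !mulNmx mul1mx.
  rewrite psiE trmx0 oppr0; congr block_mx.
    by rewrite mulNmx -mulmxA T2 mulmxN opprK mulmx1.
  by rewrite mulmxN scalerN scaleNr mulmxA.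
have [sr sl] := (jsym_mulTr sS, jsym_mulTl sS).
rewrite psiE; split.
- apply/sp_block; rewrite !linearZ /= !trmx_mul TT trmx0 !mulNmx !mulmxN sr sl.
  by rewrite !opprK oppr0.
- rewrite Ad_B0 scale_block_mx !mulmx0 !mul0mx oppr0 scaler0; congr block_mx.
    by rewrite -scalemxAr -scalemxAl !mulmxA T2 mulNmx mul1mx mulNmx scalerN opprK.
  by rewrite -!mulmxA T2 mulmxN mulmx1 mulmxN opprK scalerA ee scale1r.
- rewrite Ad_B1 scale_block_mx !mulmx0 !mul0mx oppr0 scaler0; congr block_mx.
    by rewrite -scalemxAr -scalemxAl !mulmxA T2 mulNmx mul1mx mulNmx scalerN scaleNr.
  by rewrite -!mulmxA T2 mulmxN mulmx1 mulmxN scaleNr scalerA ee scale1r.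
Qed.

End Blocks.

Arguments phi {K m}.


Section Involutions.
Variables (K : numFieldType) (N : nat) (g : {vspace 'M[K]_N}) (s : 'End('M[K]_N)).
Hypotheses (sK : forall x, s (s x) = x) (sg : {in g, forall x, s x \in g}).

Lemma involution_limg : (s @: g)%VS = g.
Proof.
apply/vspaceP => x; apply/memv_imgP/idP => [[y yg ->]|xg]; first exact: sg.
by exists (s x); rewrite ?sg ?sK.
Qed.

Lemma involution_order x0 : x0 \in g -> s x0 <> x0 -> has_order g s 2.
Proof.
move=> x0g sx0; split=> // k; have it x : iter k s x = if odd k then s x else x.
  by elim: k => //= k ->; case: (odd k).
rewrite dvdn2; split=> [/(_ _ x0g)|/negPf ek x _]; rewrite it ?ek //.
by case: (odd k).
Qed.

End Involutions.

Lemma memv_leigen (K : fieldType) (U : vectType K) (s : 'End(U)) a x :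
  (x \in passmx.leigenspace s a) = (s x == a *: x).
Proof.
by rewrite memv_ker add_lfunE opp_lfunE scale_lfunE id_lfunE subr_eq0.
Qed.

Lemma ulsubmx_linear (K : fieldType) m1 m2 : linear (@ulsubmx K m1 m2 m1 m2).
Proof. by move=> a u v; apply/matrixP=> i j; rewrite !mxE. Qed.

Section Grading.
Variables (K : numFieldType) (m : nat) (T : 'M[K]_m).
Hypotheses (TT : T^T = - T) (T2 : T *m T = - 1%:M).
Local Notation B0 := (block_mx 0 T T 0).
Local Notation B1 := (block_mx 0 T (- T) 0).
Local Notation blockE := (mul0mx, mulmx0, mulmxN, mulNmx, opprK, addr0, add0r, oppr0).

Lemma twice (X : 'M[K]_m) : T *m (T *m X *m T) *m T = X.
Proof. by rewrite !mulmxA T2 mulNmx mul1mx -mulmxA T2 mulNmx mulmxN mulmx1 opprK. Qed.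

Lemma Ad_B0K X : Ad B0 (Ad B0 X) = X.
Proof. by rewrite -[X]submxK !Ad_B0 // !blockE !twice. Qed.

Lemma Ad_B1K X : Ad B1 (Ad B1 X) = X.
Proof. by rewrite -[X]submxK !Ad_B1 // !blockE !twice. Qed.

Lemma Ad_B0B1 X : Ad B0 (Ad B1 X) = Ad B1 (Ad B0 X).
Proof. by rewrite -[X]submxK Ad_B1 // !Ad_B0 // Ad_B1 // !blockE. Qed.

Lemma tr_sandwich (X : 'M[K]_m) : (T *m X *m T)^T = T *m X^T *m T.
Proof. by rewrite !trmx_mul TT mulNmx !mulmxN opprK mulmxA. Qed.

Lemma trN (X : 'M[K]_m) : (- X)^T = - X^T.
Proof. exact: linearN. Qed.

Lemma Ad_B0_sp X : X \in sp K m -> Ad B0 X \in sp K m.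
Proof.
rewrite -{1}[X]submxK => /sp_block[Eb Ec Ed]; rewrite -[X]submxK Ad_B0 // Ed.
by apply/sp_block; split; rewrite !(trN, tr_sandwich, trmxK, mulmxN, mulNmx, opprK) ?Eb ?Ec.
Qed.

Lemma Ad_B1_sp X : X \in sp K m -> Ad B1 X \in sp K m.
Proof.
rewrite -{1}[X]submxK => /sp_block[Eb Ec Ed]; rewrite -[X]submxK Ad_B1 // Ed.
by apply/sp_block; split; rewrite !(trN, tr_sandwich, trmxK, mulmxN, mulNmx, opprK) ?Eb ?Ec.
Qed.

Lemma Ad_comm (A X Y : 'M[K]_(m + m)) : A \in unitmx ->
  Ad A (comm X Y) = comm (Ad A X) (Ad A Y).
Proof. by move=> Au; rewrite !AdE conj_comm. Qed.

Lemma B0_unit : B0 \in unitmx.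
Proof.
by case: (@mulmx1_unit _ _ B0 (- B0)); rewrite // mulmxN mulmx_block !blockE T2 opp_block_mx scalar_mx_block !blockE.
Qed.

Lemma B1_unit : B1 \in unitmx.
Proof.
by case: (@mulmx1_unit _ _ B1 B1); rewrite // mulmx_block !blockE T2 scalar_mx_block !blockE.
Qed.

Lemma lie_aut_B0 : (0 < m)%N -> lie_aut (sp K m) (Ad B0) /\ has_order (sp K m) (Ad B0) 2.
Proof.
move=> m0; split.
  split=> [|x y _ _]; last exact/Ad_comm/B0_unit.
  by apply: involution_limg Ad_B0_sp; apply: Ad_B0K.
(* [phi 1] spans the one-dimensional summand of g_11, so both automorphisms negate it. *)
apply: (@involution_order _ _ _ _ Ad_B0K (phi 1%:M)).
  by rewrite phiE; apply/sp_block; rewrite !trmx0 trmx1.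
rewrite phiE Ad_B0 // => /eq_block_mx[/matrixP/(_ (Ordinal m0) (Ordinal m0)) + _ _ _].
rewrite trmx1 mulmxN mulmx1 mulNmx opprK T2 !mxE eqxx mulr1n => /eqP.
by rewrite eq_sym -subr_eq0 opprK -mulr2n pnatr_eq0.
Qed.

Lemma lie_aut_B1 : (0 < m)%N -> lie_aut (sp K m) (Ad B1) /\ has_order (sp K m) (Ad B1) 2.
Proof.
move=> m0; split.
  split=> [|x y _ _]; last exact/Ad_comm/B1_unit.
  by apply: involution_limg Ad_B1_sp; apply: Ad_B1K.
apply: (@involution_order _ _ _ _ Ad_B1K (phi 1%:M)).
  by rewrite phiE; apply/sp_block; rewrite !trmx0 trmx1.
rewrite phiE Ad_B1 // => /eq_block_mx[/matrixP/(_ (Ordinal m0) (Ordinal m0)) + _ _ _].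
rewrite trmx1 mulmxN mulmx1 mulNmx opprK T2 !mxE eqxx mulr1n => /eqP.
by rewrite eq_sym -subr_eq0 opprK -mulr2n pnatr_eq0.
Qed.

Lemma mod_iso_psi e :
  mod_iso (phi @: jsym T 1) (phi @: jsym T 1) (psi T e @: jsym T 1).
Proof.
(* [mod_iso] asks for an endomorphism of the whole matrix space; reading the upper left block
   extends [phi a |-> psi e a] to it. *)
pose F := fun X : 'M[K]_(m + m) => psi T e (ulsubmx X).
have Flin : linear F by move=> a u v; rewrite /F ulsubmx_linear linearP.
pose L := GRing.isLinear.Build K _ _ _ F Flin.
pose FL : {linear 'M[K]_(m + m) -> 'M[K]_(m + m)} := HB.pack F L.
have FE a : linfun FL (phi a) = psi T e a by rewrite lfunE /= /F phiE block_mxKul.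
exists (linfun FL); split.
- apply/vspaceP => x; apply/memv_imgP/memv_imgP => [[_ /memv_imgP[a aS ->] ->]|[a aS ->]].
    by exists a; rewrite ?FE.
  by exists (phi a); rewrite ?memv_img ?FE.
- apply/eqP; rewrite -subv0; apply/subvP=> x /memv_capP[+ /memv_imgP[a aS Ex]].
  rewrite Ex memv_ker FE -[_ == 0]memv_ker psi_inj // memv0 => /eqP->.
  by rewrite linear0 mem0v.
move=> _ _ /memv_imgP[a aS ->] /memv_imgP[b bS ->].
by rewrite -phiM !FE psiM.
Qed.

Lemma skew_decomp : (0 < m)%N ->
  jsym T (-1) = (jskew0 T + <[1%:M]>)%VS /\ (jskew0 T :&: <[1%:M]>)%VS = 0%VS.
Proof.
move=> m0; have mR : m%:R != 0 :> K by rewrite pnatr_eq0 -lt0n.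
have S1 : (1%:M : 'M[K]_m) \in jsym T (-1) by apply/jsymP; rewrite jadj1 // scaleN1r.
split.
  apply/eqP; rewrite eqEsubv; apply/andP; split; apply/subvP=> X.
    move=> XS; rewrite -(subrK (\tr X / m%:R *: 1%:M) X) memv_add ?memvZ ?memv_line //.
    rewrite memv_cap memvB ?memvZ //= memv_ker lfunE /= linearB linearZ /=.
    by rewrite mxtrace1 /GRing.scale /= divfK ?subrr.
  case/memv_addP=> Y /memv_capP[YS _] [Z /vlineP[c ->] ->].
  by rewrite memvD ?memvZ.
apply/eqP; rewrite -subv0; apply/subvP=> X /memv_capP[XS /vlineP[c Ec]].
move: XS; rewrite {}Ec => /jskew0P[_]; rewrite linearZ /= mxtrace1 => /eqP.
by rewrite [_ == 0](mulf_eq0 c m%:R) (negPf mR) orbF => /eqP->; rewrite scale0r mem0v.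
Qed.

Lemma skew_pieces : (2 < m)%N -> exists U W : {vspace 'M[K]_(m + m)},
  [/\ (phi @: jsym T (-1))%VS = (U + W)%VS /\ directv (U + W),
      mod_irr (phi @: jsym T 1) U /\ ((\dim U).+1 * 2 + m = m * m)%N
    & stable (phi @: jsym T 1) W /\ \dim W = 1%N].
Proof.
move=> m2; have m0 : (0 < m)%N := ltnW (ltnW m2).
have [dec dir] := skew_decomp m0.
have phi0 : lker (@phi K m) == 0%VS by rewrite phi_inj.
exists (phi @: jskew0 T)%VS, (phi @: <[1%:M]>)%VS; split; split.
- by rewrite dec limgD.
- by apply/directv_addP; rewrite -lker0_img_cap // dir limg0.
- by apply: (limg_irr (phi_inj _ _) (@phiM _ _)); apply: jskew0_irr.
- by rewrite limg_dim_eq ?phi_inj ?capv0 // dim_jskew0.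
- move=> _ _ /memv_imgP[a aS ->] /memv_imgP[_ /vlineP[c ->] ->].
  by rewrite -phiM linearZ /= /comm mulmx1 mul1mx subrr scaler0 linear0 mem0v.
rewrite limg_dim_eq ?phi_inj ?capv0 // dim_vline.
suff -> : (1%:M : 'M[K]_m) != 0 by [].
by apply/eqP => /(congr1 mxtrace)/eqP; rewrite mxtrace1 mxtrace0 pnatr_eq0 -leqn0 leqNgt m0.
Qed.

End Grading.

Lemma sp_type_C (K : numFieldType) m : (0 < m)%N -> simple_of_type_C m (sp K m).
Proof.
move=> m0; split; first exact: sp_simple.
exists \1%VF; split; first exact: lim1g.
  by apply/eqP; rewrite -subv0; apply/subvP=> x /memv_capP[]; rewrite memv_ker id_lfunE memv0.
by move=> x y _ _; rewrite !id_lfunE.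
Qed.

(** For the orthogonal Q of [antidiag_congr], the map [a |-> Q^T a Q] is both a similarity, so it
    preserves brackets, and compatible with transposition, so it matches the two involutions. *)
Lemma phi_type_C (K : numFieldType) l (T := antidiag K (2 * l)) : (0 < l)%N ->
  simple_of_type_C l (phi @: jsym T 1).
Proof.
move=> l0; have em : ~~ odd (2 * l) by rewrite oddM.
have [TT T2] := (antidiag_tr K em, antidiag_sq K em).
split.
  apply: (limg_simple (phi_inj _ _) (@phiM _ _)); apply: jsym_simple => //.
  by rewrite muln_gt0.
have [|Q [QQ QQ' QJ]] := @antidiag_congr K (2 * l) l; first by rewrite mul2n addnn.
pose F := fun X : 'M[K]_(2 * l + 2 * l) => Q^T *m ulsubmx X *m Q.
have Flin : linear F.
  by move=> a u v; rewrite /F ulsubmx_linear mulmxDr mulmxDl -scalemxAr -scalemxAl.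
pose FB := GRing.isLinear.Build K _ _ _ F Flin.
pose FL : {linear 'M[K]_(2 * l + 2 * l) -> 'M[K]_(l + l)} := HB.pack F FB.
have FE a : linfun FL (phi a) = Q^T *m a *m Q by rewrite lfunE /= /F phiE block_mxKul.
have QK a : Q *m (Q^T *m a *m Q) *m Q^T = a.
  by rewrite !mulmxA QQ mul1mx -mulmxA QQ mulmx1.
have QK' a : Q^T *m (Q *m a *m Q^T) *m Q = a.
  by rewrite !mulmxA QQ' mul1mx -mulmxA QQ' mulmx1.
have EJ : Jstd K l = Q^T *m T *m Q by rewrite /T -QJ QK'.
have jadjQ a : jadj (Jstd K l) (Q^T *m a *m Q) = Q^T *m jadj T a *m Q.
  rewrite /jadj EJ !trmx_mul trmxK !mulmxA -[Q^T *m T *m Q *m Q^T]mulmxA QQ mulmx1.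
  by rewrite -[_ *m Q *m Q^T]mulmxA QQ mulmx1.
exists (linfun FL); split.
- apply/vspaceP => x; rewrite sp_jsym; apply/memv_imgP/idP.
    case=> _ /memv_imgP[a /jsymP aS ->] ->; apply/jsymP.
    by rewrite FE jadjQ aS !scale1r.
  move=> /jsymP xS; exists (phi (Q *m x *m Q^T)); last by rewrite FE QK'.
  rewrite memv_img //; apply/jsymP; rewrite scale1r.
  by rewrite -[LHS]QK -jadjQ QK' xS scale1r.
- apply/eqP; rewrite -subv0; apply/subvP=> x /memv_capP[+ /memv_imgP[a aS Ex]].
  rewrite Ex memv_ker FE => /eqP E; have := QK a; rewrite E mulmx0 mul0mx => <-.
  by rewrite linear0 mem0v.
move=> _ _ /memv_imgP[a aS ->] /memv_imgP[b bS ->]; rewrite -phiM !FE /comm.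
rewrite mulmxBr mulmxBl !mulmxA.
by rewrite -[_ *m Q *m Q^T]mulmxA QQ mulmx1 -[Q^T *m b *m Q *m Q^T]mulmxA QQ mulmx1.
Qed.



(** * Roots *)

Section KillingForm.
Variables (K : fieldType) (N : nat) (L H : {vspace 'M[K]_N}).
Local Notation M := 'M[K]_N.

Lemma killing_linr (x : M) : linear (killing L x : M -> K^o).
Proof.
move=> a u v; rewrite /killing scaler_sumr -big_split; apply: eq_bigr => i _ /=.
by rewrite commDl commZl !linearP.
Qed.

Lemma killing_linl (y : M) : linear (fun x : M => killing L x y : K^o).
Proof.
move=> a u v; rewrite /killing scaler_sumr -big_split; apply: eq_bigr => i _ /=.
by rewrite commDl commZl linearP.
Qed.

(** [kright] and [kflat] name the functions inside [killing_flat], to give them the linear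
    structures that evaluating [linfun] requires. *)
Definition kright (h h' : subvs_of H) : K^o := killing L (vsval h) (vsval h').
Lemma kright_is_linear h : linear (kright h).
Proof. by move=> a u v; rewrite /kright linearP killing_linr. Qed.
HB.instance Definition _ h := GRing.isLinear.Build K _ _ _ (kright h) (kright_is_linear h).

Definition kflat (h : subvs_of H) : dual H := linfun (kright h).
Lemma kflat_is_linear : linear kflat.
Proof.
move=> a u v; apply/lfunP => h.
by rewrite add_lfunE scale_lfunE !lfunE /= /kright linearP killing_linl.
Qed.
HB.instance Definition _ := GRing.isLinear.Build K _ _ _ kflat kflat_is_linear.

Lemma killing_flatE (h h' : subvs_of H) :
  killing_flat L H h h' = killing L (vsval h) (vsval h').
Proof.
rewrite -[killing_flat L H]/(linfun kflat) lfunE /=.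
by rewrite lfunE.
Qed.

End KillingForm.

Lemma cartan_jsym_pos (K : numClosedFieldType) n (J : 'M[K]_n) (H : {vspace 'M[K]_n}) :
    (0 < n)%N -> J^T = - J -> J *m J = - 1%:M -> cartan_subalg (jsym J 1) H ->
  exists (P : 'M[K]_n) (t : 'I_n -> 'I_n),
  [/\ P \in unitmx, involutive t /\ (forall i, t i != i),
      forall i j, ((P^T *m J *m P) i j != 0) = (j == t i)
    & forall X, X \in H <-> exists d : 'rV_n,
        (forall i, d 0 (t i) = - d 0 i) /\ X = P *m diag_mx d *m invmx P].
Proof. by case: n J H => // n J H _ JT JJ cH; exact: (cartan_jsym JT JJ cH). Qed.

(** * Weights of a Cartan subalgebra on [S+] and [S-] *)

Section RootSystem.
Variables (K : numClosedFieldType) (m : nat) (T : 'M[K]_m).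
Hypotheses (TT : T^T = - T) (T2 : T *m T = - 1%:M).
Variables (H : {vspace 'M[K]_(m + m)}) (P : 'M[K]_m) (t : 'I_m -> 'I_m).
Local Notation L := (jsym T 1).
Local Notation g := (sp K m).
Local Notation G := (P^T *m T *m P).
Hypotheses (HL : (H <= phi @: L)%VS) (Pu : P \in unitmx) (tK : involutive t)
  (tN : forall i, t i != i) (Gt : forall i j, (G i j != 0) = (j == t i))
  (HP : forall X, phi X \in H <-> exists d : 'rV_m,
        (forall i, d 0 (t i) = - d 0 i) /\ X = P *m diag_mx d *m invmx P).

Definition eps_fun i (h : subvs_of H) : K^o := (invmx P *m ulsubmx (vsval h) *m P) i i.
Lemma eps_is_linear i : linear (eps_fun i).
Proof.
move=> a u v; rewrite /eps_fun linearP ulsubmx_linear mulmxDr mulmxDl.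
by rewrite -scalemxAr -scalemxAl !mxE.
Qed.
HB.instance Definition _ i := GRing.isLinear.Build K _ _ _ (eps_fun i) (eps_is_linear i).
Definition eps i : dual H := linfun (eps_fun i).

Lemma eps_spec (h : subvs_of H) : exists d : 'rV_m,
  [/\ forall i, d 0 (t i) = - d 0 i, vsval h = phi (P *m diag_mx d *m invmx P)
    & forall i, eps i h = d 0 i].
Proof.
have hH := subvsP h; have /memv_imgP[X _ EX] := subvP HL _ hH.
rewrite EX in hH; have [d [dt Ed]] := (HP X).1 hH; rewrite Ed in EX.
exists d; split=> // i; rewrite lfunE /= /eps_fun EX phiE block_mxKul.
by rewrite !mulmxA mulVmx // mul1mx mulmxKV // mxE eqxx mulr1n.
Qed.

Lemma eps_t i : eps (t i) = - eps i.
Proof.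
apply/lfunP => h; rewrite opp_lfunE; have [d [dt _ E]] := eps_spec h.
by rewrite !E dt.
Qed.

Lemma eps_surj (d : 'I_m -> K) : (forall i, d (t i) = - d i) ->
  exists h, forall i, eps i h = d i.
Proof.
move=> dt; pose D := \row_i d i; have : phi (P *m diag_mx D *m invmx P) \in H.
  by apply/HP; exists D; split=> // i; rewrite !mxE dt.
move=> hH; exists (vsproj H (phi (P *m diag_mx D *m invmx P))) => i.
rewrite lfunE /= /eps_fun vsprojK // phiE block_mxKul.
by rewrite !mulmxA mulVmx // mul1mx mulmxKV // !mxE eqxx mulr1n.
Qed.

Lemma eps_ext (h h' : subvs_of H) : (forall i, eps i h = eps i h') -> h = h'.
Proof.
have [d [_ Eh Ed]] := eps_spec h; have [d' [_ Eh' Ed']] := eps_spec h'.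
move=> E; apply: val_inj; rewrite [LHS]Eh [RHS]Eh'.
by suff -> : d = d' by []; apply/rowP=> i; rewrite -Ed -Ed' E.
Qed.

Local Notation c := (((m + m).+2)%:R *+ 2 : K).

(** The Killing form of g is [(2m + 2) tr(xy)], and the two diagonal blocks of [phi] contribute
    equal traces: hence [c = 2(2m + 2)]. *)
Lemma killing_eps (h h' : subvs_of H) :
  killing g (vsval h) (vsval h') = c * \sum_k eps k h * eps k h'.
Proof.
have hsp (u : subvs_of H) : vsval u \in g.
  have := subvP HL _ (subvsP u); rewrite -(eigen_diag TT T2) ?mulr1 //.
  by case.
rewrite killing_sp //.
have [d [_ -> Ed]] := eps_spec h; have [d' [_ -> Ed']] := eps_spec h'.
rewrite !phiE mulmx_block !(mul0mx, mulmx0, addr0, add0r) mulNmx mulmxN opprK.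
rewrite mxtrace_block -trmx_mul mxtrace_tr [X in _ + X]mxtrace_mulC -mulr2n.
rewrite mulrnAr -mulrnAl; congr (_ * _).
rewrite -!mulmxA (mulmxA (invmx P)) mulVmx // mul1mx mxtrace_mulC -!mulmxA mulVmx // mulmx1.
rewrite /mxtrace; apply: eq_bigr => k _; rewrite Ed Ed' mul_diag_mx !mxE eqxx mulr1n.
by [].
Qed.

Let c0 : c != 0. Proof. by rewrite mulrn_eq0 pnatr_eq0. Qed.

Lemma killing_flat_inj : lker (killing_flat g H) == 0%VS.
Proof.
rewrite -subv0; apply/subvP=> h; rewrite memv_ker memv0 => /eqP E.
apply/eqP/eps_ext => i; rewrite linear0.
have [h' Eh'] : exists h', forall k, eps k h' = (k == i)%:R - (k == t i)%:R.
  apply: eps_surj => k; rewrite opprB (can2_eq tK tK) (inj_eq (can_inj tK)).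
  by [].
have := congr1 (fun f : dual H => f h') E.
rewrite killing_flatE killing_eps zero_lfunE => /eqP.
rewrite mulf_eq0 (negPf c0) (bigD1 i) //= (bigD1 (t i)) ?tN //= big1.
  rewrite !Eh' !eqxx [i == t i]eq_sym (negPf (tN i)) addr0 subr0 sub0r eps_t opp_lfunE.
  by rewrite mulrNN !mulr1 -mulr2n mulrn_eq0 => /eqP.
by move=> k /andP[ki kti]; rewrite Eh' (negPf ki) (negPf kti) subr0 mulr0.
Qed.

Lemma dual_form0 : dual_form g (0 : dual H) 0 = 0.
Proof. by rewrite /dual_form linear0 -killing_flatE !linear0. Qed.

Lemma dual_form_eps i j : j != t i ->
  dual_form g (eps i + eps j) (eps i + eps j) = c^-1 * (1 + (i == j)%:R).
Proof.
move=> jti.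
(* [h i'] represents [eps i'] for the Killing form. It is supported at i' and [t i'], whose equal
   contributions account for the extra 2 in the denominator. *)
have /choice[h Eh] : forall i', exists h, forall k,
    eps k h = ((k == i')%:R - (k == t i')%:R) / (c *+ 2).
  move=> i'.
  apply: (eps_surj (d := fun k => ((k == i')%:R - (k == t i')%:R) / (c *+ 2))) => k.
  by rewrite (can2_eq tK tK) (inj_eq (can_inj tK)) -mulNr opprB.
have flat_h k : killing_flat g H (h k) = eps k.
  apply/lfunP => h'; rewrite killing_flatE killing_eps.
  rewrite (bigD1 k) //= (bigD1 (t k)) ?tN //= big1 => [|r /andP[rk rtk]].
    rewrite !Eh !eqxx [k == t k]eq_sym (negPf (tN k)) eps_t opp_lfunE.
    rewrite !mulr0n !mulr1n; move: (eps k h' : K) c0 => x; move: c => y y0.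
    by field.
  by rewrite Eh (negPf rk) (negPf rtk) subrr !mul0r.
pose u := h i + h j; have Eu : killing_flat g H u = eps i + eps j.
  by have /= := linearD (killing_flat g H) (h i) (h j); rewrite !flat_h.
rewrite /dual_form -killing_flatE -!Eu (lker0_lfunK killing_flat_inj) Eu add_lfunE.
have itj : (i == t j) = false by rewrite -(can2_eq tK tK) eq_sym (negPf jti).
rewrite /u !(linearD (eps _)) /= !Eh !eqxx [i == t i]eq_sym [j == t j]eq_sym !(negPf (tN _)) itj (negPf jti).
rewrite [j == i]eq_sym !mulr0n !mulr1n; move: ((i == j)%:R : K) c0 => x; move: c => y y0.
by field.
Qed.

Definition is_weight b (a : dual H) := exists s : 'M[K]_m,
  [/\ s \in jsym T ((-1) ^+ b), s != 0
    & forall h : subvs_of H, comm (ulsubmx (vsval h)) s = a h *: s].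

Lemma is_weight_eps (b : bool) i j : (b -> i != j) -> is_weight b (eps i + eps j).
Proof.
move=> bij; pose p k := col k P.
exists (dyad T (p i) (p j) + (-1) ^+ b *: dyad T (p j) (p i)); split.
- apply/jsymP; rewrite linearD linearZ /= !(jadj_dyad TT T2) scalerDr scalerA.
  by rewrite -expr2 sqrr_sign scale1r addrC.
- have Nu : P^T *m T \in unitmx.
    rewrite unitmx_mul unitmx_tr Pu /=.
    by case: (@mulmx1_unit _ _ T (- T)); rewrite // mulmxN T2 opprK.
  have E k l : dyad T (p k) (p l) = P *m delta_mx k l *m (P^T *m T).
    by rewrite /dyad /p !colE trmx_mul trmx_delta !mulmxA -[P *m _ *m delta_mx 0 l]mulmxA mul_delta_mx.
  move: (P^T *m T) Nu E => N Nu E.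
  rewrite !E scalemxAl -mulmxDl scalemxAr -mulmxDr.
  apply/eqP => /(congr1 (fun A => invmx P *m A *m invmx N)).
  rewrite mulmx0 mul0mx !mulmxA mulVmx // mul1mx mulmxK // => /matrixP/(_ i j)/eqP.
  have nb : i = j -> b = false by move=> /eqP ij; apply/negP => /bij; rewrite ij.
  rewrite !mxE !eqxx /=; have [/[dup] ij /nb->|/negPf ij] := eqVneq i j.
    by rewrite /= expr0 mul1r -mulr2n pnatr_eq0.
  by rewrite /= mulr0 addr0 oner_eq0.
move=> h; have [d [dt Eh Ed]] := eps_spec h.
have hL : ulsubmx (vsval h) \in L.
  have /memv_imgP[X XL ->] := subvP HL _ (subvsP h).
  by rewrite phiE block_mxKul.
have Ep k : ulsubmx (vsval h) *m p k = eps k h *: p k.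
  rewrite Eh phiE block_mxKul Ed /p !colE mulmxA mulmxKV // -mulmxA -[diag_mx d *m _]colE.
  rewrite scalemxAr; congr (P *m _).
  apply/matrixP=> r l; rewrite !mxE (ord1 l) eqxx andbT.
  by case: eqVneq => [->|_]; rewrite ?mulr1n ?mulr0n ?mulr1 ?mulr0.
have /jsymP hLE := hL; rewrite scale1r in hLE.
have cd u v : comm (ulsubmx (vsval h)) (dyad T u v) =
    dyad T (ulsubmx (vsval h) *m u) v + dyad T u (ulsubmx (vsval h) *m v).
  by rewrite /comm mul_dyad (dyad_mul TT T2) hLE opprK.
rewrite linearD linearZ /= !cd !Ep !dyadZl !dyadZr -!scalerDl add_lfunE scalerDr.
by rewrite [eps j h + _]addrC !scalerA [_ * (_ + _)]mulrC.
Qed.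

Lemma is_weightP (b : bool) (a : dual H) : a <> 0 ->
  is_weight b a <-> exists i j, [/\ j != t i, b -> i != j & a = eps i + eps j].
Proof.
move=> a0; split=> [[s [sS s0 sw]]|[i [j [_ bij ->]]]]; last exact: is_weight_eps.
pose Y := invmx P *m s *m P; have Es : s = P *m Y *m invmx P.
  by rewrite /Y !mulmxA mulmxV // mul1mx mulmxK.
have [k [l Ykl]] : exists k l, Y k l != 0.
  apply: contrapT => Y0; case/eqP: s0; rewrite Es.
  suff -> : Y = 0 by rewrite mulmx0 mul0mx.
  apply/matrixP=> k l; rewrite [RHS]mxE; apply/eqP; apply: contrapT => /negP nY.
  by apply: Y0; exists k, l.
have Ea : a = eps k + eps (t l).
  apply/lfunP => h; rewrite eps_t add_lfunE opp_lfunE.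
  have [d [dt Eh Ed]] := eps_spec h; have := sw h.
  rewrite Eh phiE block_mxKul Es conj_comm // => /(congr1 (fun A => invmx P *m A *m P)).
  rewrite -scalemxAr -scalemxAl !mulmxA mulVmx // !mul1mx !mulmxKV // => /matrixP/(_ k l).
  by rewrite comm_diag [RHS]mxE !Ed => /(mulIf Ykl) ->.
exists k, (t l); split=> //.
  apply/eqP => /(can_inj tK) lk; apply: a0.
  by rewrite Ea lk eps_t subrr.
case: b sS => // sS _; apply/eqP => kl; case/eqP: Ykl; rewrite kl.
(* For s in [S-] the matrix [T s] is skew, and so is A. Its diagonal entry at l is [G l (t l)] times
   [Y (t l) l], so the latter vanishes: this excludes [eps k + eps k]. *)
pose A := P^T *m T *m s *m P.
have EA : A = G *m Y by rewrite /A /Y !mulmxA mulmxK.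
have AT : A^T = - A.
  have /jsymP := sS; rewrite expr1 scaleN1r /jadj => E.
  have Es' : s^T *m T = T *m s.
    by apply: oppr_inj; rewrite -[RHS]mulmxN -E !mulmxA T2 !mulNmx mul1mx.
  have -> : A^T = P^T *m (s^T *m (- T)) *m P by rewrite /A !trmx_mul trmxK TT !mulmxA.
  by rewrite mulmxN Es' mulmxN mulNmx /A !mulmxA.
have All : A l l = 0.
  have := congr1 (fun B : 'M[K]_m => B l l) AT; rewrite [LHS]mxE oppmxE => E.
  exact: (@eq_oppr0 K K^o).
move: All; rewrite EA mxE (bigD1 (t l)) //= big1 => [/eqP|r rt].
  by rewrite addr0 mulf_eq0 => /orP[E|/eqP//]; have := Gt l (t l); rewrite E eqxx.
by have := Gt l r; rewrite (negPf rt) => /negbT; rewrite negbK => /eqP->; rewrite mul0r.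
Qed.

End RootSystem.



Lemma signz_odd (F : fieldType) (p : int) : (-1 : F) ^ p = (-1) ^+ odd `|p|%N.
Proof.
case: p => n; first by rewrite -exprnP signr_odd.
by rewrite -[LHS]/((-1) ^- n.+1) -[`|_|%N]/(n.+1) -signr_odd invr_sign.
Qed.

(** * Weights of the toroidal algebra *)

Section MonolConv.
Variables (K : fieldType) (U V W : lmodType K) (op : U -> V -> W).
Hypotheses (op0l : forall y, op 0 y = 0) (op0r : forall x, op x 0 = 0).

Lemma conv_monol0 x (f : laurent V) r : Defs.conv op0l op0r (monol x 0) f r = op x (f r).
Proof.
rewrite /= -(@fsbig_widen _ _ _ _ [set 0] [set: int * int]) ?fsbig_set1 ?eqxx ?subr0 //.
by move=> s [_ /eqP s0] /=; rewrite (negPf s0).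
Qed.

Lemma conv_zerol (f : laurent V) : Defs.conv op0l op0r 0 f = 0.
Proof. by apply: laurentP => r /=; apply: fsbig1 => s _; exact: op0l. Qed.

End MonolConv.

Section Toroidal.
Variable R : realType.
Local Notation C := R[i].

Lemma zeta2 : zeta R 2 = -1.
Proof.
rewrite /zeta (_ : 2 * pi / 2%:R = pi); last by rewrite mulrAC mulfV ?mul1r ?pnatr_eq0.
by rewrite cospi sinpi; apply/eqP; rewrite eq_complex /= oppr0 !eqxx.
Qed.

Lemma der_monol0 (V : lmodType C) (x : V) (p : int * int -> int) :
  p 0 = 0 -> der p (monol x 0) = 0.
Proof.
move=> p0; apply: laurentP => r /=; case: eqP => [->|_]; last by rewrite scaler0.
by rewrite p0 scale0r.
Qed.

Lemma memv_leigenC N (s : 'End('M[R[i]]_N)) (a : R[i]) x :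
  (x \in passmx.leigenspace s a) = (s x == a *: x).
Proof. exact: memv_leigen. Qed.
Lemma gcomp_eigenP N (gg : {vspace 'M[R[i]]_N}) (s0 s1 : 'End('M[R[i]]_N)) p q X : X \in gcomp gg s0 s1 2 2 p q <->
  [/\ X \in gg, s0 X = (-1) ^+ odd `|p|%N *: X & s1 X = (-1) ^+ odd `|q|%N *: X].
Proof.
rewrite /gcomp zeta2 !signz_odd; split=> [/memv_capP[/memv_capP[Xg X0] X1]|[Xg E0 E1]].
  split.
  - exact: Xg.
  - apply/eqP; rewrite -memv_leigenC; exact: X0.
  - apply/eqP; rewrite -memv_leigenC; exact: X1.
apply/memv_capP; split; first (apply/memv_capP; split; first exact: Xg).
  by rewrite memv_leigenC E0.
by rewrite memv_leigenC E1.
Qed.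
Lemma derK0 (p : int * int -> int) : derK p (0 : KR C) = 0.
Proof.
by rewrite -(raddf0 (@class C)) derK_class /derO /= !linear0.
Qed.

Variables (l : nat).
Hypothesis hl : (2 <= l)%N.
Local Notation m := (2 * l)%N.
Local Notation T := (antidiag C m).
Local Notation g := (sp C m).
Local Notation g_ p q := (gcomp g (Ad (A0 C l)) (Ad (A1 C l)) 2 2 p q).

Let em : ~~ odd m. Proof. by rewrite oddM. Qed.
Let TT : T^T = - T. Proof. exact: antidiag_tr. Qed.
Let T2 : T *m T = - 1%:M. Proof. exact: antidiag_sq. Qed.
Let m2 : (2 < m)%N. Proof. by move: hl; lia. Qed.

Lemma gcompP p q X : X \in g_ p q <->
  [/\ X \in g, Ad (block_mx 0 T T 0) X = (-1) ^+ odd `|p|%N *: X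
    & Ad (block_mx 0 T (- T) 0) X = (-1) ^+ odd `|q|%N *: X].
Proof.
have E0 : A0 C l = block_mx 0 T T 0 by exact: A0_block.
have E1 : A1 C l = block_mx 0 T (- T) 0 by exact: A1_block.
by rewrite gcomp_eigenP E0 E1.
Qed.

Lemma gcomp_same p q : odd `|q|%N = odd `|p|%N ->
  g_ p q = (phi @: jsym T ((-1) ^+ odd `|p|%N))%VS.
Proof.
move=> E; apply/vspaceP => X; apply/idP/idP.
  by move=> /gcompP; rewrite E => /(eigen_diag TT T2); apply; rewrite -expr2 sqrr_sign.
by move=> h; apply/gcompP; rewrite E; apply/(eigen_diag TT T2); rewrite // -expr2 sqrr_sign.
Qed.

Lemma gcomp_anti p q : odd `|q|%N = ~~ odd `|p|%N ->
  g_ p q = (psi T ((-1) ^+ odd `|p|%N) @: jsym T 1)%VS.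
Proof.
move=> E; have EN : (-1) ^+ odd `|q|%N = - (-1) ^+ odd `|p|%N :> C.
  by rewrite E; case: (odd _); rewrite ?expr0 ?expr1 ?opprK.
apply/vspaceP => X; apply/idP/idP.
  by move=> /gcompP; rewrite EN => /(eigen_anti TT T2); apply; rewrite -expr2 sqrr_sign.
by move=> h; apply/gcompP; rewrite EN; apply/(eigen_anti TT T2); rewrite // -expr2 sqrr_sign.
Qed.

Section Roots.
Variables (H : {vspace 'M[C]_(m + m)}) (P : 'M[C]_m) (t : 'I_m -> 'I_m).
Local Notation L := (jsym T 1).
Local Notation G := (P^T *m T *m P).
Hypotheses (HL : (H <= phi @: L)%VS) (Pu : P \in unitmx) (tK : involutive t)
  (tN : forall i, t i != i) (Gt : forall i j, (G i j != 0) = (j == t i))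
  (HP : forall X, phi X \in H <-> exists d : 'rV_m,
        (forall i, d 0 (t i) = - d 0 i) /\ X = P *m diag_mx d *m invmx P).
Local Notation eps := (@eps _ _ H P).

(** [phi] and [psi] are injective and intertwine the action of [S+], so each piece has the weights
    of [S+], except g_11, which has those of [S-]; [odd p && odd q] singles it out. *)
Lemma gcomp_weight p q (a : dual H) :
  (exists x, [/\ x \in g_ p q, x != 0 & forall h : subvs_of H, comm (vsval h) x = a h *: x])
  <-> is_weight T (odd `|p|%N && odd `|q|%N) a.
Proof.
have hL (h : subvs_of H) : vsval h = phi (ulsubmx (vsval h)) /\ ulsubmx (vsval h) \in L.
  have /memv_imgP[X XL ->] := subvP HL _ (subvsP h).
  by have -> : ulsubmx (phi X) = X by rewrite phiE block_mxKul.
suff main b (f : 'Hom('M[C]_m, 'M[C]_(m + m))) : lker f = 0%VS ->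
    (forall x s, x \in L -> f (comm x s) = comm (phi x) (f s)) ->
    (exists x, [/\ x \in (f @: jsym T ((-1) ^+ nat_of_bool b))%VS, x != 0
       & forall h : subvs_of H, comm (vsval h) x = a h *: x]) <-> is_weight T b a.
  have [E|E] := eqVneq (odd `|q|%N) (odd `|p|%N).
    rewrite gcomp_same // E andbb; apply: main; first exact: phi_inj.
    by move=> x s _; rewrite phiM.
  have Eq : odd `|q|%N = ~~ odd `|p|%N by move: E; case: (odd `|q|%N); case: (odd `|p|%N).
  rewrite gcomp_anti // Eq andbN; apply: (main false); first exact: psi_inj.
  by move=> x s xL; rewrite psiM.
move=> f0 fM; have finj : injective f by apply/lker0P; rewrite f0.
split=> [[_ [/memv_imgP[s sS ->] s0 sw]]|[s [sS s0 sw]]].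
  exists s; split=> //; first by apply: contra_neq s0 => ->; rewrite linear0.
  move=> h; have [Eh hl'] := hL h; apply: finj.
  by rewrite fM // -Eh sw linearZ.
exists (f s); split; first exact: memv_img.
  by apply: contra_neq s0 => E; apply: finj; rewrite E linear0.
by move=> h; have [Eh hl'] := hL h; rewrite Eh -fM // sw linearZ.
Qed.

Local Notation c := (((m + m).+2)%:R *+ 2 : C).
Let c_gt0 : 0 < c^-1. Proof. by rewrite invr_gt0 pmulrn_rgt0 // ltr0n. Qed.

Let form_eps := dual_form_eps TT T2 HL Pu tK tN HP.

(* [Defs.roots] compares a with 0 as functions, not as elements of [dual H]. *)
Lemma roots_eps (a : dual H) : Defs.roots (g_ 0 0) a <->
  exists i j, j != t i /\ a = eps i + eps j.
Proof.
have wP (a1 : dual H) : a1 <> 0 -> _ := is_weightP TT T2 HL Pu tK Gt HP false (a := a1).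
rewrite /Defs.roots /=; split=> [[af0 [x [xg x0 xw]]]|[i [j [jt Ea]]]].
  have a0 : a <> 0 by move=> E; apply: af0; apply/funext => h; rewrite E zero_lfunE.
  have aw : is_weight T false a by apply/(gcomp_weight 0 0); exists x.
  have [i [j [jt _ Ea]]] := (wP a a0).1 aw.
  by exists i, j.
have a0 : a <> 0.
  move=> a0; have := form_eps jt; rewrite -Ea a0 dual_form0 => /esym/eqP.
  by rewrite mulf_eq0 (gt_eqF c_gt0) /=; case: (i == j); rewrite ?addr0 ?oner_eq0 // -mulr2n pnatr_eq0.
split; last by apply/(gcomp_weight 0 0)/(wP a a0); exists i, j.
move=> E; apply: a0; apply/lfunP => h; rewrite zero_lfunE.
exact: (congr1 (fun f => f h) E).
Qed.

(** The square lengths are [2/c] for i = j and [1/c] otherwise, with c positive; a root with i != j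
    is shorter than [eps i + eps i]. *)
Lemma long_eps (a : dual H) :
  long_roots g (Ad (A0 C l)) (Ad (A1 C l)) 2 2 a <-> exists i, a = eps i + eps i.
Proof.
have dt i : i != t i by rewrite eq_sym tN.
split=> [[/roots_eps[i [j [jt Ea]]] amax]|[i Ea]].
  have [ij|ij] := eqVneq i j; first by exists i; rewrite Ea ij.
  have rii : Defs.roots (g_ 0 0) (eps i + eps i) by apply/roots_eps; exists i, i.
  have := amax _ rii; rewrite Ea !form_eps // eqxx (negPf ij) addr0.
  by rewrite ler_pM2l // -subr_ge0 opprD addrA subrr sub0r oppr_ge0 ler10.
split; first by apply/roots_eps; exists i, i.
move=> b /roots_eps[k [j [jt ->]]]; rewrite Ea !form_eps // eqxx.
by rewrite ler_pM2l // lerD2l; case: (k == j); rewrite ?ler01.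
Qed.

Lemma short_eps (a : dual H) :
  short_roots g (Ad (A0 C l)) (Ad (A1 C l)) 2 2 a <->
  exists i j, [/\ i != j, j != t i & a = eps i + eps j].
Proof.
split=> [[/roots_eps[i [j [jt Ea]]] amin]|[i [j [ij jt Ea]]]].
  have [ij|ij] := eqVneq i j; last by exists i, j.
  (* As m > 2, some index avoids i and [t i]; it gives a root of half the square length, so
     [eps i + eps i] is not minimal. *)
  have [k /andP[ki kt]] : exists k, (k != i) && (k != t i).
    apply/existsP; apply: contraLR m2; rewrite negb_exists -leqNgt => /forallP h.
    rewrite -[m]card_ord -cardsT; apply: leq_trans (_ : #|[set i; t i]%SET| <= 2)%N; last first.
      by rewrite cards2; case: (_ != _).
    apply/subset_leq_card/fintype.subsetP => k _; rewrite !inE.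
    by have := h k; rewrite negb_and !negbK.
  have rik : Defs.roots (g_ 0 0) (eps i + eps k) by apply/roots_eps; exists i, k.
  have := amin _ rik; rewrite Ea !form_eps // ij eqxx -ij eq_sym (negPf ki) addr0.
  by rewrite ler_pM2l // -subr_ge0 opprD addrA subrr sub0r oppr_ge0 ler10.
split; first by apply/roots_eps; exists i, j.
move=> b /roots_eps[k [k' [kt ->]]]; rewrite Ea !form_eps // (negPf ij).
by rewrite ler_pM2l // lerD2l; case: (k == k'); rewrite ?ler01.
Qed.

Lemma tor_bracket_cartan (h : subvs_of H) (u : laurent 'M[C]_(m + m)) k (a0 a1 c0 c1 x0 x1 : C) r :
  (tor_bracket g (cartan_elt h a0 a1 c0 c1) (u, k, x0, x1)).1.1.1 r =
  comm (vsval h) (u r) + (a0 * (r.1)%:~R + a1 * (r.2)%:~R) *: u r.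
Proof.
have -> : (tor_bracket g (cartan_elt h a0 a1 c0 c1) (u, k, x0, x1)).1.1.1 =
  commL (monol (vsval h) 0) u + (a0 *: der fst u + a1 *: der snd u)
  - (x0 *: der fst (monol (vsval h) 0) + x1 *: der snd (monol (vsval h) 0)) by [].
rewrite !der_monol0 // !scaler0 addr0 subr0 !laurentDE !laurentZE scalerDl -!scalerA.
by congr (_ + _); apply: conv_monol0.
Qed.

(** [h (x) 1] has zero derivatives, so the cocycle vanishes, and [k0], [k1] have degree zero, so the
    [x0], [x1] terms vanish too. Hence H acts trivially on this component. *)
Lemma tor_bracket_cartan_K (h : subvs_of H) (u : laurent 'M[C]_(m + m)) k (a0 a1 c0 c1 x0 x1 : C) :
  (tor_bracket g (cartan_elt h a0 a1 c0 c1) (u, k, x0, x1)).1.1.2 =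
  a0 *: derK fst k + a1 *: derK snd k.
Proof.
pose w : Omega C := (monol (c0 : C^o) 0, monol (c1 : C^o) 0).
have -> : (tor_bracket g (cartan_elt h a0 a1 c0 c1) (u, k, x0, x1)).1.1.2 =
  cocycle g (monol (vsval h) 0) u + (a0 *: derK fst k + a1 *: derK snd k)
  - (x0 *: derK fst (class w) + x1 *: derK snd (class w)) by [].
have w0 p : p 0 = 0 -> derK p (class w) = 0.
  by move=> p0; rewrite derK_class /derO !der_monol0 // raddf0.
rewrite !w0 // !scaler0 addr0 subr0 /cocycle !der_monol0 //.
have Z : killingL g 0 u = 0 by apply: conv_zerol.
by rewrite Z raddf0 add0r.
Qed.

Theorem nonisotropic_roots_eps :
  nonisotropic_roots g (Ad (A0 C l)) (Ad (A1 C l)) 2 2 (H := H) =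
  ears_C11star g (Ad (A0 C l)) (Ad (A1 C l)) 2 2 (H := H).
Proof.
have wP b (a1 : dual H) : a1 <> 0 -> _ := is_weightP TT T2 HL Pu tK Gt HP b (a := a1).
have even_prod (p q : int) : (2 %| p * q)%Z = ~~ (odd `|p|%N && odd `|q|%N).
  by rewrite dvdzE abszM dvdn2 oddM.
apply/seteqP; split=> [[[a b0] b1]|[[a b0] b1]].
  case=> /= form0 [[[[u k] x0] x1] [[ug _] xw] xn0].
  have a0 : a <> 0 by move=> a0; apply: form0; rewrite /formV /= a0 dual_form0.
  (* Such an h acts by zero on the differential and derivation components, so these vanish in a
     weight vector and only the loop part u remains. *)
  have [h ah] : exists h, a h != 0.
    apply: contrapT => nh; apply: a0; apply/lfunP => h; rewrite zero_lfunE.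
    by apply/eqP; apply: contrapT => /negP ah; apply: nh; exists h.
  have xw' h' a0' a1' := xw h' a0' a1' 0 0.
  have k0 : k = 0.
    have := congr1 (fun x : toroidal R (m + m) => x.1.1.2) (xw' h 0 0).
    rewrite tor_bracket_cartan_K !scale0r addr0 /weight_eval /= !mulr0 !addr0.
    by move=> /esym/eqP; rewrite scaler_eq0 (negPf ah) => /eqP.
  have x00 : x0 = 0.
    have := congr1 (fun x : toroidal R (m + m) => x.1.2) (xw' h 0 0).
    rewrite /weight_eval /= !mulr0 !addr0 => /esym/eqP.
    by rewrite scaler_eq0 (negPf ah) => /eqP.
  have x10 : x1 = 0.
    have := congr1 (fun x : toroidal R (m + m) => x.2) (xw' h 0 0).
    rewrite /weight_eval /= !mulr0 !addr0 => /esym/eqP.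
    by rewrite scaler_eq0 (negPf ah) => /eqP.
  have [r ur] : exists r, u r != 0.
    apply: contrapT => nu; apply: xn0; rewrite k0 x00 x10.
    suff -> : u = 0 by [].
    apply: laurentP => r; apply/eqP; apply: contrapT => /negP ur.
    by apply: nu; exists r.
  (* At a nonzero coefficient of u, [d0] and [d1] read off its degree, while H sees a weight of the
     graded piece of that degree. *)
  have uw h' a0' a1' : comm (vsval h') (u r) + (a0' * (r.1)%:~R + a1' * (r.2)%:~R) *: u r
      = (a h' + b0 * a0' + b1 * a1') *: u r.
    have := congr1 (fun x : toroidal R (m + m) => x.1.1.1 r) (xw' h' a0' a1').
    by rewrite tor_bracket_cartan.
  have Eb0 : b0 = (r.1)%:~R.
    have := uw 0 1 0; rewrite !linear0 /comm mul0mx mulmx0 subrr !add0r mul1r mul0r addr0.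
    rewrite mulr0 mulr1 addr0 => /eqP; rewrite -subr_eq0 -scalerBl scaler_eq0 (negPf ur) orbF.
    by rewrite subr_eq0 => /eqP.
  have Eb1 : b1 = (r.2)%:~R.
    have := uw 0 0 1; rewrite !linear0 /comm mul0mx mulmx0 subrr !add0r mul1r mul0r add0r.
    rewrite mulr0 mulr1 add0r => /eqP; rewrite -subr_eq0 -scalerBl scaler_eq0 (negPf ur) orbF.
    by rewrite subr_eq0 => /eqP.
  have aw : is_weight T (odd `|r.1|%N && odd `|r.2|%N) a.
    apply/gcomp_weight; exists (u r); split=> // h'.
    by have := uw h' 0 0; rewrite !mul0r !mulr0 !addr0 scale0r addr0.
  have [i [j [jt bij Ea]]] := (wP _ a a0).1 aw.
  have [ij|ij] := eqVneq i j.
    left; exists a, r.1, r.2; split; last by rewrite Eb0 Eb1.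
      by apply/long_eps; exists i; rewrite Ea ij.
    by rewrite even_prod; apply/negP => /bij; rewrite ij eqxx.
  right; exists a, r.1, r.2; split; last by rewrite Eb0 Eb1.
  by apply/short_eps; exists i, j.
(* Both halves of the union fit one description: a long root is the case i = j, where the
   implication says that p and q are not both odd. *)
move=> Hb; suff [i [j [p [q [jt bij -> -> Ea]]]]] : exists i j (p q : int),
    [/\ j != t i, odd `|p|%N && odd `|q|%N -> i != j, b0 = p%:~R, b1 = q%:~R & a = eps i + eps j].
  split.
    rewrite /formV /= Ea form_eps // => /eqP.
    by rewrite mulf_eq0 (gt_eqF c_gt0) /=; case: (i == j); rewrite ?addr0 ?oner_eq0 // -mulr2n pnatr_eq0.
  have [x [xg x0 xw]] := (gcomp_weight p q a).2 ltac:(rewrite Ea; exact: is_weight_eps).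
  exists (monol x (p, q), 0, 0, 0); last first.
    move=> /(congr1 (fun y : toroidal R (m + m) => y.1.1.1 (p, q))) /=.
    by rewrite eqxx => E; rewrite E eqxx in x0.
  split.
    split=> [r /=|]; first by case: eqP => [->|_]; rewrite ?mem0v.
    by exists 0; split=> //; rewrite raddf0.
  move=> h a0 a1 c0 c1; set w := weight_eval _ _ _ _ _ _.
  pose B := tor_bracket g (cartan_elt h a0 a1 c0 c1) (monol x (p, q), 0, 0, 0).
  rewrite -[LHS]/(B.1.1.1, B.1.1.2, 0 : C^o, 0 : C^o).
  have -> : B.1.1.1 = w *: monol x (p, q).
    apply: laurentP => r; rewrite tor_bracket_cartan laurentZE /=.
    case: eqP => [->|_]; last by rewrite comm0r !scaler0 addr0.
    by rewrite xw -scalerDl /w /weight_eval /= addrA [p%:~R * _]mulrC [q%:~R * _]mulrC.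
  have -> : B.1.1.2 = w *: (0 : KR C).
    by rewrite tor_bracket_cartan_K !derK0 !scaler0 addr0.
  by rewrite -[in LHS](scaler0 C^o w).
case: Hb => [[a' [p [q [/long_eps[i Ea] pq [-> -> ->]]]]]|[a' [p [q [/short_eps[i [j [ij jt Ea]]] [-> -> ->]]]]]].
  exists i, i, p, q; split=> //; first by rewrite eq_sym tN.
  by rewrite even_prod in pq; rewrite (negPf pq).
by exists i, j, p, q; split.
Qed.

End Roots.
End Toroidal.

Theorem mainTheorem10 (R : realType) (l : nat) (hl : (2 <= l)%N) :
  let g := sp R[i] (2 * l) in
  let s0 := Ad (A0 R[i] l) in
  let s1 := Ad (A1 R[i] l) in
  let g_ (p q : int) := gcomp g s0 s1 2 2 p q in
  [/\ simple_of_type_C (2 * l) g,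
      lie_aut g s0 /\ has_order g s0 2,
      lie_aut g s1 /\ has_order g s1 2
    & commuting_on g s0 s1] /\
  [/\ simple_of_type_C l (g_ 0 0),
      mod_iso (g_ 0 0) (g_ 0 0) (g_ 0 1),
      mod_iso (g_ 0 0) (g_ 0 0) (g_ 1 0),
      exists U W : {vspace 'M[R[i]]_(2 * l + 2 * l)},
        [/\ g_ 1 1 = (U + W)%VS /\ directv (U + W),
            mod_irr (g_ 0 0) U /\ \dim U = (2 * l ^ 2 - l - 1)%N
          & stable (g_ 0 0) W /\ \dim W = 1%N]
    & forall H : {vspace 'M[R[i]]_(2 * l + 2 * l)},
        cartan_subalg (g_ 0 0) H ->
        nonisotropic_roots g s0 s1 2 2 (H := H) =
        ears_C11star g s0 s1 2 2 (H := H)].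
Proof.
have em : ~~ odd (2 * l) by rewrite oddM.
have l0 : (0 < l)%N by apply: leq_trans hl.
have m2 : (2 < 2 * l)%N by lia.
have m0 : (0 < 2 * l)%N by lia.
have TT := antidiag_tr R[i] em; have T2 := antidiag_sq R[i] em.
have E0 : A0 R[i] l = block_mx 0 (antidiag R[i] (2 * l)) (antidiag R[i] (2 * l)) 0.
  exact: A0_block.
have E1 : A1 R[i] l = block_mx 0 (antidiag R[i] (2 * l)) (- antidiag R[i] (2 * l)) 0.
  exact: A1_block.
move=> g s0 s1 g_.
have g00 : g_ 0 0 = (phi @: jsym (antidiag R[i] (2 * l)) 1)%VS by exact: gcomp_same.
have g01 : g_ 0 1 = (psi (antidiag R[i] (2 * l)) 1 @: jsym (antidiag R[i] (2 * l)) 1)%VS.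
  exact: gcomp_anti.
have g10 : g_ 1 0 = (psi (antidiag R[i] (2 * l)) (-1) @: jsym (antidiag R[i] (2 * l)) 1)%VS.
  exact: gcomp_anti.
have g11 : g_ 1 1 = (phi @: jsym (antidiag R[i] (2 * l)) (-1))%VS by exact: gcomp_same.
split; split.
- exact: sp_type_C.
- by rewrite /s0 E0; apply: lie_aut_B0.
- by rewrite /s1 E1; apply: lie_aut_B1.
- by move=> x _; rewrite /s0 /s1 E0 E1; apply: Ad_B0B1.
- by rewrite g00; apply: phi_type_C.
- by rewrite g00 g01; apply: mod_iso_psi.
- by rewrite g00 g10; apply: mod_iso_psi.
- have [U [W [dec [irr dU] sW]]] := skew_pieces TT T2 m2.
  exists U, W; rewrite g00 g11; split=> //; split=> //.
  by move: dU => {dec irr sW}; set d := \dim U; rewrite -mulnn; nia.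
move=> H; rewrite g00 => cH; have [HL _ _ _] := cH.
have [P [t [Pu [tK tN] Gt HP]]] :=
  cartan_jsym_pos m0 TT T2 (preim_cartan (phi_inj _ _) (@phiM _ _) cH).
apply: (nonisotropic_roots_eps hl HL Pu tK tN Gt) => X.
by rewrite -HP -memv_preim.
Qed.
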